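(* Let $\mathcal{M}_0$ denote the set of smooth space-like curves $\gamma:\mathbb{R}\to\mathbb{R}^{2,1}$ with $\langle\gamma_x,\gamma_x\rangle=1$ such that the principal curvature along one null parallel normal field is constant. Then the space-like normalized geometric Airy flow $$\gamma_t=\tfrac18\langle H(\gamma),H(\gamma)\rangle e_0+\tfrac14\nabla^\perp_{e_0}H(\gamma)$$ on $\mathbb{R}^{2,1}$ leaves $\mathcal{M}_0$ invariant. Moreover, if $\gamma$ is a solution of this flow on $\mathcal{M}_0$, then there is $g=(e_0,e_1,e_2):\mathbb{R}^2\to O(3,D_3)$ satisfying: (i) $g(\cdot,t)$ is a null p-frame for $\gamma(\cdot,t)$ and $$g^{-1}g_x=k_1\left(e_{21}-\tfrac12e_{13}\right)+2\left(e_{31}-\tfrac12e_{12}\right)$$ (so the null principal curvature $k_2$ along $e_2$ is equal to $2$); (ii) $q=-\frac12k_1$ satisfies the KdV equation $q_t=\frac14(q_{xxx}-6qq_x)$.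
   Context: $\mathbb{R}^{2,1}$ is $\mathbb{R}^3$ with $\langle v,w\rangle=v^tD_3w$, $D_3=\begin{pmatrix}1&0&0\\0&0&\frac12\\0&\frac12&0\end{pmatrix}$; $O(3,D_3)=\{A\in GL(3,\mathbb{R}):A^tD_3A=D_3\}$. In (i), $e_{ij}$ denotes the $3\times3$ elementary matrix (while $e_0,e_1,e_2$ with a single index are the columns of $g$). For a space-like curve with $\langle\gamma_x,\gamma_x\rangle=1$, a null p-frame is $g=(e_0,e_1,e_2)$ with values in $O(3,D_3)$, $e_0=\gamma_x$, and $$g^{-1}g_x=\begin{pmatrix}0&-\frac{k_2}{2}&-\frac{k_1}{2}\\k_1&0&0\\k_2&0&0\end{pmatrix};$$ $e_1,e_2$ are null parallel normal fields and $k_i$ is the principal curvature along $e_i$. $H(\gamma)=\gamma_{xx}=k_1e_1+k_2e_2$ is the mean curvature vector, and $\nabla^\perp_{e_0}H$ is the component of $H_x$ normal to $\gamma$, i.e. $(k_1)_xe_1+(k_2)_xe_2$. A solution of the flow on $\mathcal{M}_0$ is a solution $\gamma(x,t)$ with $\gamma(\cdot,t)\in\mathcal{M}_0$ for all $t$.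
   Formalization: In ''Moreover'' the constant curvature is taken nonzero (a straight line is a counterexample); invariance means the flow is tangent to M_0 and solutions with curvatures and first two x-derivatives bounded, locally uniformly in t, stay in M_0 (uniqueness fails otherwise). *)

(* Defs.v *)
From Stdlib Require Import Reals.
From Coquelicot Require Import Coquelicot.
From mathcomp Require Import all_boot all_order all_algebra.
From mathcomp Require Import Rstruct.

Set Implicit Arguments.
Unset Strict Implicit.
Unset Printing Implicit Defensive.

Import Order.TTheory GRing.Theory Num.Theory.
Local Open Scope ring_scope.

(* Matrices are MathComp matrices over the classical reals; calculus is
   Coquelicot's, applied entrywise. *)

Definition mx3 (rows : seq (seq R)) : 'M[R]_3 :=
  \matrix_(i < 3, j < 3) nth 0 (nth [::] rows i) j.

Definition D3 : 'M[R]_3 :=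
  mx3 [:: [:: 1; 0; 0]; [:: 0; 0; 2^-1]; [:: 0; 2^-1; 0]].

Definition inner (v w : 'cV[R]_3) : R := (v^T *m D3 *m w) 0 0.

Definition O3D3 (A : 'M[R]_3) : Prop :=
  A \in unitmx /\ A^T *m D3 *m A = D3.

Definition Dmx m n (f : R -> 'M[R]_(m, n)) (x : R) : 'M[R]_(m, n) :=
  \matrix_(i, j) Derive (fun y => f y i j) x.

Definition smooth (f : R -> R) : Prop := forall n x, ex_derive_n f n x.

Definition smooth_mx m n (f : R -> 'M[R]_(m, n)) : Prop :=
  forall i j, smooth (fun x => f x i j).

Fixpoint C2d (n : nat) (f : R -> R -> R) : Prop :=
  (forall x t, continuity_2d_pt f x t) /\
  match n with
  | 0 => True
  | n'.+1 =>
      [/\ forall x t : R, ex_derive (fun y => f y t) x /\ ex_derive (f x) t,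
          C2d n' (fun x t => Derive (fun y => f y t) x)
        & C2d n' (fun x t => Derive (f x) t)]
  end.

Definition smooth2 (f : R -> R -> R) : Prop := forall n, C2d n f.

Definition smooth2_mx m n (f : R -> R -> 'M[R]_(m, n)) : Prop :=
  forall i j, smooth2 (fun x t => f x t i j).

Definition unit_speed (c : R -> 'cV[R]_3) : Prop :=
  forall x, inner (Dmx c x) (Dmx c x) = 1.

Definition frame_mx (k1 k2 : R) : 'M[R]_3 :=
  mx3 [:: [:: 0; - (k2 / 2); - (k1 / 2)]; [:: k1; 0; 0]; [:: k2; 0; 0]].

(* [g = (e_0, e_1, e_2)] is given by its columns; [k1], [k2] are determined
   by [g]. *)
Record null_p_frame (c : R -> 'cV[R]_3) (g : R -> 'M[R]_3) (k1 k2 : R -> R)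
    : Prop := {
  frame_smooth : smooth_mx g;
  frame_O : forall x, O3D3 (g x);
  frame_tangent : forall x, col 0 (g x) = Dmx c x;
  frame_eq : forall x, invmx (g x) *m Dmx g x = frame_mx (k1 x) (k2 x)
}.

Definition has_constant_curvature (c : R -> 'cV[R]_3) (a : R) : Prop :=
  exists g k1 k2, null_p_frame c g k1 k2 /\
    ((forall x, k1 x = a) \/ (forall x, k2 x = a)).

Definition M0 (c : R -> 'cV[R]_3) : Prop :=
  [/\ smooth_mx c, unit_speed c & exists a, has_constant_curvature c a].

(* A null field [e_i] may be rescaled by a nonzero constant (its partner being
   rescaled by the inverse), so a constant curvature can be normalized to 2
   exactly when it is nonzero. *)
Definition M0_nonzero (c : R -> 'cV[R]_3) : Prop :=
  [/\ smooth_mx c, unit_speed c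
    & exists a, a <> 0 /\ has_constant_curvature c a].

Definition mean_curvature (c : R -> 'cV[R]_3) : R -> 'cV[R]_3 := Dmx (Dmx c).

Definition normal_derivative_H (c : R -> 'cV[R]_3) (x : R) : 'cV[R]_3 :=
  let Hx := Dmx (mean_curvature c) x in
  let e0 := Dmx c x in
  Hx - inner Hx e0 *: e0.

Definition airy_velocity (c : R -> 'cV[R]_3) (x : R) : 'cV[R]_3 :=
  (8^-1 * inner (mean_curvature c x) (mean_curvature c x)) *: Dmx c x
  + 4^-1 *: normal_derivative_H c x.

Definition airy_solution (gam : R -> R -> 'cV[R]_3) : Prop :=
  [/\ smooth2_mx gam,
      forall t, unit_speed (fun x => gam x t)
    & forall x t, Dmx (gam x) t = airy_velocity (fun y => gam y t) x].

(* [v] is the velocity at [s = 0] of a smooth family of curves lying in [M]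
   and passing through [c]. *)
Definition tangent_to (M : (R -> 'cV[R]_3) -> Prop) (c : R -> 'cV[R]_3)
    (v : R -> 'cV[R]_3) : Prop :=
  exists Gam : R -> R -> 'cV[R]_3,
    [/\ smooth2_mx Gam,
        forall s, M (fun x => Gam x s),
        forall x, Gam x 0 = c x
      & forall x, Dmx (Gam x) 0 = v x].

(* Principal curvatures bounded, with their first two derivatives, uniformly
   for [t] in compact sets. Without a condition at [x = oo] smooth solutions
   are not unique: [k1 = 0], [k2 = 2 + v] with [v] a nonzero null solution of
   [v_t = v_xxx / 4] (supported in [t >= 0]) gives two solutions issued from
   the same curve. *)
Definition locally_bounded_curvature (gam : R -> R -> 'cV[R]_3) : Prop :=
  exists (g : R -> R -> 'M[R]_3) (k1 k2 : R -> R -> R),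
    [/\ smooth2_mx g,
        forall t, null_p_frame (fun x => gam x t) (fun x => g x t)
                    (fun x => k1 x t) (fun x => k2 x t)
      & forall T : R, exists C : R, forall (n : nat) (x t : R),
          (n <= 2)%nat -> `|t| <= T ->
          `|Derive_n (fun y => k1 y t) n x| <= C /\
          `|Derive_n (fun y => k2 y t) n x| <= C].

(* The flow leaves [M] invariant: its velocity field is tangent to [M] along
   [M], and solutions in the uniqueness class above stay in [M]. *)
Definition airy_invariant (M : (R -> 'cV[R]_3) -> Prop) : Prop :=
  (forall c, M c -> tangent_to M c (airy_velocity c)) /\
  (forall gam, airy_solution gam -> locally_bounded_curvature gam ->
     forall t0, M (fun x => gam x t0) -> forall t, M (fun x => gam x t)).

Definition KdV (q : R -> R -> R) : Prop :=
  smooth2 q /\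
  forall x t, Derive (q x) t =
    4^-1 * (Derive_n (fun y => q y t) 3 x
            - 6 * q x t * Derive (fun y => q y t) x).

(* Main.v *)
(** In a null p-frame evolving with the flow the curvatures satisfy
    [(k_i)_t = k_i''' / 4 + 3/8 k_1 k_2 k_i' -/+ c(t) k_i], where [c] is the gauge
    freedom of boosting the null normal fields by a function of time. If [k_2] is
    constant at time [t0], then [k_2 - a exp (int c)] solves a linear third-order
    equation with zero data at [t0]. It vanishes: a cutoff of width [L] makes its
    local energy satisfy a Gronwall inequality with an error [O(1/L)], the
    boundedness of [w], [w'], [w''] compensating for the term in [w'^2], which has no
    sign.

    For tangency no frame equation has to be integrated. If [k_2 = a <> 0], then
    [c + (2/a) e_1] is a fixed point, so [c] lies on a light cone, and conformal
    reparametrizations of curves on the cone preserve unit speed and realize the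
    flow direction. If [k_2 = 0], then [e_1] is constant and [c + s/4 k_1' e_1]
    does it.

    For KdV, with [k_2 = 2] one has [k_1 = <H, H> / 2], which is smooth in [(x, t)]
    however the frames are chosen at different times. *)

Require Import Defs.
From Stdlib Require Import Reals Lra FunctionalExtensionality IndefiniteDescription.
From Coquelicot Require Import Coquelicot.
From mathcomp Require Import all_boot all_order all_algebra.
From mathcomp Require Import Rstruct.
Set Implicit Arguments.
Unset Strict Implicit.
Unset Printing Implicit Defensive.
Import Order.TTheory GRing.Theory Num.Theory.
Local Open Scope ring_scope.

(** * Smooth functions of two variables *)

(** The boost gauge is chosen so that the only [x]-derivatives left in the equation of [k_2] are
    those of [k_2]. With [3/8 k_1 k_2] frozen as a given coefficient that equation is linear and
    homogeneous, and [a exp (int c)] is its [x]-independent solution; [k_1] enters only through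
    bounds on the coefficient.

    The constant curvature at time [t0] is known in some frame of that one curve, whereas the bounds
    are known in another frame, smooth in [(x, t)]. Two null p-frames of one curve differ by a
    constant boost, up to interchanging the null fields, so constancy passes to the second frame at
    the cost of a nonzero factor.

    The equation [w_t = w'''/4] smooths in neither time direction, and invariance is claimed before
    and after [t0], so the Gronwall inequality is two-sided.

    Tangency asks for the right velocity at [s = 0] only, so explicit families can replace solutions
    of the flow.

    A normalized frame smooth in [(x, t)] comes from the uniqueness argument, hence only under the
    curvature bounds; otherwise frames are chosen separately at each time. *)

Definition Dx (f : R -> R -> R) (x t : R) : R := Derive (fun y => f y t) x.
Definition Dt (f : R -> R -> R) (x t : R) : R := Derive (f x) t.

Lemma is_deriveD (f g : R -> R) (x df dg : R) :
  is_derive f x df -> is_derive g x dg ->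
  is_derive (fun y => f y + g y) x (df + dg).
Proof. exact: is_derive_plus. Qed.

Lemma is_deriveN (f : R -> R) (x df : R) :
  is_derive f x df -> is_derive (fun y => - f y) x (- df).
Proof. exact: is_derive_opp. Qed.

Lemma is_deriveB (f g : R -> R) (x df dg : R) :
  is_derive f x df -> is_derive g x dg ->
  is_derive (fun y => f y - g y) x (df - dg).
Proof. exact: is_derive_minus. Qed.

Lemma is_derive_cst (a x : R) : is_derive (fun=> a) x 0%R.
Proof. exact: is_derive_const. Qed.

Lemma is_derive_idr (x : R) : is_derive (fun y : R => y) x 1%R.
Proof. exact: is_derive_id. Qed.

Lemma is_deriveM (f g : R -> R) (x df dg : R) :
  is_derive f x df -> is_derive g x dg ->
  is_derive (fun y => f y * g y) x (df * g x + f x * dg).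
Proof. by move=> fx gx; apply: is_derive_mult => // a b; apply: Rmult_comm. Qed.

Lemma is_deriveV (f : R -> R) (x df : R) :
  is_derive f x df -> f x != 0 ->
  is_derive (fun y => (f y)^-1) x (- df * (f x)^-1 * (f x)^-1).
Proof.
move=> fx /eqP fx0; have := is_derive_inv f x df fx fx0.
congr is_derive; rewrite /Rdiv /= Rmult_1_r Rinv_mult; symmetry; exact: Rmult_assoc.
Qed.

Lemma is_derive_comp1 (f g : R -> R) (x df dg : R) :
  is_derive f (g x) df -> is_derive g x dg ->
  is_derive (fun y => f (g y)) x (dg * df).
Proof. exact: is_derive_comp. Qed.

Lemma is_derive_eq (f : R -> R) (x l l' : R) :
  is_derive f x l -> l = l' -> is_derive f x l'.
Proof. by move=> ? <-. Qed.

Lemma C2dS n f : C2d n.+1 f <->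
  [/\ forall x t, continuity_2d_pt f x t,
      forall x t, ex_derive (fun y => f y t) x /\ ex_derive (f x) t,
      C2d n (Dx f) & C2d n (Dt f)].
Proof. by split=> [[? [? ? ?]]|[? ? ? ?]]; split. Qed.

Lemma C2d_cont n f x t : C2d n f -> continuity_2d_pt f x t.
Proof. by case: n => [|n] []. Qed.

(** Needed for product and chain rules, which multiply a derivative, one order less regular, by an
    undifferentiated factor. *)
Lemma C2dW n f : C2d n.+1 f -> C2d n f.
Proof.
elim: n f => [|n IHn] f /C2dS[cf df fx ft]; first by split.
by apply/C2dS; split=> //; apply: IHn.
Qed.

Lemma C2d_cst n a : C2d n (fun=> fun=> a).
Proof.
elim: n a => [|n IHn] a; first by split=> // x t; apply: continuity_2d_pt_const.
apply/C2dS; split; first by move=> x t; apply: continuity_2d_pt_const.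
- by move=> x t; split; apply: ex_derive_const.
- suff -> : Dx (fun=> fun=> a) = (fun=> fun=> 0) by [].
  by do 2!apply: functional_extensionality => ?; apply: Derive_const.
- suff -> : Dt (fun=> fun=> a) = (fun=> fun=> 0) by [].
  by do 2!apply: functional_extensionality => ?; apply: Derive_const.
Qed.

Lemma C2dD n f g : C2d n f -> C2d n g -> C2d n (fun x t => f x t + g x t).
Proof.
elim: n f g => [|n IHn] f g.
  by case=> cf _ [cg _]; split=> // x t; apply: continuity_2d_pt_plus.
case/C2dS=> cf df fx ft /C2dS[cg dg gx gt]; apply/C2dS; split.
- by move=> x t; apply: continuity_2d_pt_plus.
- move=> x t; have [[? ?] [? ?]] := (df x t, dg x t).
  by split; apply: (ex_derive_plus (V := R_NormedModule)).
- rewrite (_ : Dx _ = fun x t => Dx f x t + Dx g x t); first exact: IHn.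
  do 2!apply: functional_extensionality => ?; apply: Derive_plus.
    exact: (df _ _).1.
  exact: (dg _ _).1.
- rewrite (_ : Dt _ = fun x t => Dt f x t + Dt g x t); first exact: IHn.
  do 2!apply: functional_extensionality => ?; apply: Derive_plus.
    exact: (df _ _).2.
  exact: (dg _ _).2.
Qed.

Lemma C2dM n f g : C2d n f -> C2d n g -> C2d n (fun x t => f x t * g x t).
Proof.
elim: n f g => [|n IHn] f g.
  by case=> cf _ [cg _]; split=> // x t; apply: continuity_2d_pt_mult.
move=> Cf Cg; have [Cfn Cgn] := (C2dW Cf, C2dW Cg).
case/C2dS: Cf => cf df fx ft; case/C2dS: Cg => cg dg gx gt.
have eM (u v : R -> R) (x : R) : ex_derive u x -> ex_derive v x ->
    Derive (fun y => u y * v y) x = Derive u x * v x + u x * Derive v x.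
  by move=> ? ?; apply: Derive_mult.
apply/C2dS; split.
- by move=> x t; apply: continuity_2d_pt_mult.
- move=> x t; have [[? ?] [? ?]] := (df x t, dg x t).
  by split; apply: ex_derive_mult.
- rewrite (_ : Dx _ = fun x t => Dx f x t * g x t + f x t * Dx g x t).
    by apply: C2dD; apply: IHn.
  do 2!apply: functional_extensionality => ?; apply: eM.
    exact: (df _ _).1.
  exact: (dg _ _).1.
- rewrite (_ : Dt _ = fun x t => Dt f x t * g x t + f x t * Dt g x t).
    by apply: C2dD; apply: IHn.
  do 2!apply: functional_extensionality => ?; apply: eM.
    exact: (df _ _).2.
  exact: (dg _ _).2.
Qed.

Lemma C2dN n f : C2d n f -> C2d n (fun x t => - f x t).
Proof.
move=> Cf; rewrite (_ : (fun x t => _) = fun x t => -1 * f x t).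
  exact: C2dM (C2d_cst n (-1)) Cf.
by do 2!apply: functional_extensionality => ?; rewrite mulN1r.
Qed.

Lemma C2dV n f : (forall x t, f x t != 0) -> C2d n f ->
  C2d n (fun x t => (f x t)^-1).
Proof.
move=> f0; elim: n => [|n IHn] Cf.
  by split=> // x t; apply: continuity_2d_pt_inv; [case: Cf | apply/eqP].
have IHf := IHn (C2dW Cf); case/C2dS: Cf => cf df fx ft.
have dV (u : R -> R) (x : R) : ex_derive u x -> u x != 0 ->
    is_derive (fun y => (u y)^-1) x (- Derive u x * (u x)^-1 * (u x)^-1).
  by move=> ux ux0; apply: is_deriveV => //; apply: Derive_correct.
apply/C2dS; split.
- by move=> x t; apply: continuity_2d_pt_inv => //; apply/eqP.
- move=> x t; have [? ?] := df x t.
  by split; eexists; apply: (dV (fun _ => _)) => //; apply: f0.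
- rewrite (_ : Dx _ = fun x t => - Dx f x t * (f x t)^-1 * (f x t)^-1).
    by do 2!(apply: C2dM => //); apply: C2dN.
  do 2!apply: functional_extensionality => ?; apply: is_derive_unique.
  by apply: (dV (fun _ => _)) => //; apply: (df _ _).1.
- rewrite (_ : Dt _ = fun x t => - Dt f x t * (f x t)^-1 * (f x t)^-1).
    by do 2!(apply: C2dM => //); apply: C2dN.
  do 2!apply: functional_extensionality => ?; apply: is_derive_unique.
  by apply: (dV (fun _ => _)) => //; apply: (df _ _).2.
Qed.

Lemma smooth_ex_derive f x : smooth f -> ex_derive f x.
Proof. by move=> /(_ 1%N x). Qed.

Lemma smooth_Derive f : smooth f -> smooth (Derive f).
Proof.
move=> sf [|n] x //=; have /= := sf n.+2 x; apply: ex_derive_ext => y.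
by elim: n y => //= n IHn y; apply: Derive_ext.
Qed.

Lemma C2d_comp n f p : smooth f -> C2d n p -> C2d n (fun x t => f (p x t)).
Proof.
have ccomp (u : R -> R) q x t : smooth u -> continuity_2d_pt q x t ->
    continuity_2d_pt (fun x t => u (q x t)) x t.
  move=> su cq; apply: continuity_1d_2d_pt_comp => //.
  apply: derivable_continuous_pt; apply: ex_derive_Reals_0.
  exact: smooth_ex_derive.
elim: n f => [|n IHn] f sf Cp.
  by split=> // x t; apply: ccomp => //; case: Cp.
have IHp := IHn _ (smooth_Derive sf) (C2dW Cp).
case/C2dS: Cp => cp dp px pt; apply/C2dS; split.
- by move=> x t; apply: ccomp.
- move=> x t; have [? ?] := dp x t.
  by split; apply: (ex_derive_comp f) => //; apply: smooth_ex_derive.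
- rewrite (_ : Dx _ = fun x t => Dx p x t * Derive f (p x t)); first exact: C2dM.
  do 2!apply: functional_extensionality => ?; apply: (Derive_comp f).
    exact: smooth_ex_derive.
  exact: (dp _ _).1.
- rewrite (_ : Dt _ = fun x t => Dt p x t * Derive f (p x t)); first exact: C2dM.
  do 2!apply: functional_extensionality => ?; apply: (Derive_comp f).
    exact: smooth_ex_derive.
  exact: (dp _ _).2.
Qed.

Lemma smooth2_cst a : smooth2 (fun=> fun=> a).
Proof. by move=> n; apply: C2d_cst. Qed.

Lemma smooth2D f g : smooth2 f -> smooth2 g -> smooth2 (fun x t => f x t + g x t).
Proof. by move=> sf sg n; apply: C2dD. Qed.

Lemma smooth2M f g : smooth2 f -> smooth2 g -> smooth2 (fun x t => f x t * g x t).
Proof. by move=> sf sg n; apply: C2dM. Qed.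

Lemma smooth2N f : smooth2 f -> smooth2 (fun x t => - f x t).
Proof. by move=> sf n; apply: C2dN. Qed.

Lemma smooth2V f : (forall x t, f x t != 0) -> smooth2 f ->
  smooth2 (fun x t => (f x t)^-1).
Proof. by move=> f0 sf n; apply: C2dV. Qed.

Lemma smooth2_comp f p : smooth f -> smooth2 p -> smooth2 (fun x t => f (p x t)).
Proof. by move=> sf sp n; apply: C2d_comp. Qed.

Lemma smooth2_Dx f : smooth2 f -> smooth2 (Dx f).
Proof. by move=> sf n; have /C2dS[] := sf n.+1. Qed.

Lemma smooth2_Dt f : smooth2 f -> smooth2 (Dt f).
Proof. by move=> sf n; have /C2dS[] := sf n.+1. Qed.

Lemma smooth2_cont f x t : smooth2 f -> continuity_2d_pt f x t.
Proof. by move=> /(_ 0%N)/C2d_cont. Qed.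

Lemma smooth2_derx f x t : smooth2 f -> is_derive (fun y => f y t) x (Dx f x t).
Proof. by move=> /(_ 1%N)/C2dS[_ /(_ x t)[+ _] _ _]; apply: Derive_correct. Qed.

Lemma smooth2_dert f x t : smooth2 f -> is_derive (f x) t (Dt f x t).
Proof. by move=> /(_ 1%N)/C2dS[_ /(_ x t)[_ +] _ _]; apply: Derive_correct. Qed.

Lemma smooth2_fst : smooth2 (fun x _ => x).
Proof.
move=> [|n]; first by split=> // x t; apply: continuity_2d_pt_id1.
apply/C2dS; split; first by move=> x t; apply: continuity_2d_pt_id1.
- by move=> x t; split; [apply: ex_derive_id | apply: ex_derive_const].
- suff -> : Dx (fun x _ => x) = (fun=> fun=> 1) by apply: C2d_cst.
  by do 2!apply: functional_extensionality => ?; apply: Derive_id.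
- suff -> : Dt (fun x _ => x) = (fun=> fun=> 0) by apply: C2d_cst.
  by do 2!apply: functional_extensionality => ?; apply: Derive_const.
Qed.

Lemma smooth2_swap f : smooth2 f -> smooth2 (fun x t => f t x).
Proof.
suff H n g : C2d n g -> C2d n (fun x t => g t x) by move=> sf n; apply: H.
have csw h x t : continuity_2d_pt h t x -> continuity_2d_pt (fun x t => h t x) x t.
  move=> ch e; have [d hd] := ch e; exists d => u v ? ?; exact: hd.
elim: n g => [|n IHn] g; first by case=> cg _; split=> // x t; apply: csw.
case/C2dS=> cg dg gx gt; apply/C2dS; split.
- by move=> x t; apply: csw.
- by move=> x t; have [] := dg t x.
- exact: IHn gt.
- exact: IHn gx.
Qed.

Lemma smooth2_snd : smooth2 (fun _ t => t).
Proof. exact: smooth2_swap smooth2_fst. Qed.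

Lemma smooth2_lift f : smooth f -> smooth2 (fun x _ => f x).
Proof. by move=> sf; apply: smooth2_comp sf smooth2_fst. Qed.

Lemma smooth2_liftt f : smooth f -> smooth2 (fun _ t => f t).
Proof. by move=> sf; apply: smooth2_comp sf smooth2_snd. Qed.

Lemma Derive_n_Dx f n x t :
  Derive_n (fun y => f y t) n x = iter n Dx f x t.
Proof. by elim: n x => //= n IHn x; apply: Derive_ext. Qed.

Lemma smooth2_iter f n : smooth2 f -> smooth2 (iter n Dx f).
Proof. by elim: n => //= n IHn sf; apply/smooth2_Dx/IHn. Qed.

Lemma smooth2_slice f t : smooth2 f -> smooth (fun x => f x t).
Proof.
move=> sf [|n] x //=; have := smooth2_derx x t (smooth2_iter n sf).
move=> H; exists (Dx (iter n Dx f) x t); apply: is_derive_ext H => y.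
by rewrite Derive_n_Dx.
Qed.

Lemma smooth2_slicet f x : smooth2 f -> smooth (f x).
Proof. by move=> /smooth2_swap/(smooth2_slice x). Qed.

Lemma smooth2_Schwarz f : smooth2 f -> Dx (Dt f) = Dt (Dx f).
Proof.
move=> sf; do 2!apply: functional_extensionality => ?; apply: Schwarz.
- exists (mkposreal 1 Rlt_0_1) => u v _ _; split; last split; last split.
  + by eexists; apply: smooth2_derx.
  + by eexists; apply: smooth2_dert.
  + by eexists; apply: smooth2_derx (smooth2_Dt sf).
  + by eexists; apply: smooth2_dert (smooth2_Dx sf).
- exact: (smooth2_cont _ _ (smooth2_Dx (smooth2_Dt sf))).
- exact: (smooth2_cont _ _ (smooth2_Dt (smooth2_Dx sf))).
Qed.

(* One-variable closure properties are slices of the two-variable ones. *)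
Lemma smooth_of2 f : smooth2 (fun x _ => f x) -> smooth f.
Proof. exact: (smooth2_slice 0). Qed.

(** Coinduction: a class of differentiable functions stable under [Derive] consists of smooth
    functions, so no formula for an n-th derivative is required. *)
Lemma smooth_coind (P : (R -> R) -> Prop) :
  (forall f, P f -> (forall x, ex_derive f x) /\ P (Derive f)) ->
  forall f, P f -> smooth f.
Proof.
move=> HP f Pf n; have Pn k : P (Derive_n f k).
  by elim: k => //= k /HP[].
by case: n => [|n] x //=; have /HP[] := Pn n.
Qed.

Lemma smooth_exp : smooth exp.
Proof.
apply: (@smooth_coind (fun f => f = exp)) => // f ->; split.
  by move=> x; exists (exp x); apply: is_derive_exp.
by apply: functional_extensionality => x; apply: is_derive_unique; apply: is_derive_exp.
Qed.

(** * Integrals depending on a parameter *)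

Section RealAnalysis.
Local Open Scope R_scope.

Lemma smooth2_contx f x t : smooth2 f -> continuous (fun y => f y t) x.
Proof.
by move=> sf; apply: ex_derive_continuous; eexists; apply: smooth2_derx.
Qed.

Lemma smooth2_ex_RInt f a b t : smooth2 f -> ex_RInt (fun y => f y t) a b.
Proof.
by move=> sf; apply: (ex_RInt_continuous (V := R_CompleteNormedModule)) => x _;
  apply: smooth2_contx.
Qed.

Lemma smooth2_RInt_derx f a x t : smooth2 f ->
  is_derive (fun x => RInt (fun y => f y t) a x) x (f x t).
Proof.
move=> sf; apply: (is_derive_RInt (fun y => f y t) _ a); last exact: smooth2_contx.
by apply: filter_forall => y; apply: RInt_correct; apply: smooth2_ex_RInt.
Qed.

Lemma smooth2_RInt_dert f a b t : smooth2 f ->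
  is_derive (fun t => RInt (fun y => f y t) a b) t (RInt (fun y => Dt f y t) a b).
Proof.
move=> sf; apply: (is_derive_RInt_param (fun t y => f y t)).
- by apply: filter_forall => s y _; eexists; apply: smooth2_dert.
- by move=> y _; exact: (smooth2_cont t y (smooth2_swap (smooth2_Dt sf))).
- by apply: filter_forall => s; apply: smooth2_ex_RInt.
Qed.

(** Differentiating in [x] gives back [f], and differentiating in [t] gives an integral of the same
    kind with [Dt f]. Every order therefore reduces to joint continuity of such integrals. *)
Lemma smooth2_RInt f a : smooth2 f ->
  smooth2 (fun x t => RInt (fun y => f y t) a x).
Proof.
suff cI g : smooth2 g ->
    forall x t, continuity_2d_pt (fun x t => RInt (fun y => g y t) a x) x t.
  move=> sf n; elim: n f sf => [|n IHn] f sf; first by split=> //; apply: cI.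
  apply/C2dS; split; first exact: cI.
  - move=> x t; split; first by eexists; apply: smooth2_RInt_derx.
    by eexists; apply: smooth2_RInt_dert.
  - suff -> : Dx (fun x t => RInt (fun y => f y t) a x) = f by [].
    do 2!apply: functional_extensionality => ?; apply: is_derive_unique.
    exact: smooth2_RInt_derx.
  - rewrite (_ : Dt _ = fun x t => RInt (fun y => Dt f y t) a x).
      by apply/IHn/smooth2_Dt.
    do 2!apply: functional_extensionality => ?; apply: is_derive_unique.
    exact: smooth2_RInt_dert.
move=> sg x t e.
have e2 : Rlt 0 (e / 2) by have := cond_pos e; lra.
have [d1 hd1] := @smooth2_cont _ x t sg (mkposreal 1 Rlt_0_1).
pose F x t := RInt (fun y => g y t) a x.
have cF : continuity_pt (F x) t.
  apply: derivable_continuous_pt; apply: ex_derive_Reals_0.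
  by eexists; apply: smooth2_RInt_dert.
have [d2 [d2_gt0 hd2]] := cF _ e2.
pose M := (Rabs (g x t) + 1).
have M_gt0 : Rlt 0 M by have := Rabs_pos (g x t); rewrite /M; lra.
have eM : Rlt 0 (e / 2 / M) by apply: Rdiv_lt_0_compat.
have d_gt0 : Rlt 0 (Rmin (Rmin d1 d2) (e / 2 / M)).
  by do ?apply: Rmin_pos => //; apply: cond_pos.
exists (mkposreal _ d_gt0) => u v /= hu hv.
have [m1 m2] := (Rmin_l (Rmin d1 d2) (e / 2 / M), Rmin_r (Rmin d1 d2) (e / 2 / M)).
have [m3 m4] := (Rmin_l d1 d2, Rmin_r d1 d2).
(* The increment is split at [(x, v)]. The horizontal part equals [g c v * (u - x)], and [g] is
   bounded by [M] near [(x, t)]; the vertical part is continuity of [F x] at [t]. *)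
have [c [[c1 c2] ec]] := MVT_gen (fun x => F x v) x u (fun y => g y v)
  (fun y _ => smooth2_RInt_derx a y v sg)
  (fun y _ => derivable_continuous_pt _ _ (ex_derive_Reals_0 _ _
     (ex_intro _ _ (smooth2_RInt_derx a y v sg)))).
have hcx : Rle (Rabs (Rminus c x)) (Rabs (Rminus u x)).
  move: c1 c2; rewrite /Rmin /Rmax /Rabs.
  by case: Rle_dec => ?; do 2!case: Rcase_abs => ?; lra.
have hc := hd1 c v ltac:(lra) ltac:(lra).
have hM : Rle (Rabs (g c v)) M.
  by have := Rabs_triang_inv (g c v) (g x t); rewrite /= in hc; rewrite /M; lra.
have hF : Rlt (Rabs (Rminus (F x v) (F x t))) (e / 2).
  have [->|ne] := Req_dec t v; first by rewrite Rminus_diag Rabs_R0; lra.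
  apply: hd2; split; first by split.
  by rewrite /= /Rdist; lra.
have hP : Rlt (Rabs (Rmult (g c v) (Rminus u x))) (e / 2).
  rewrite Rabs_mult; apply: (Rle_lt_trans _ (M * Rabs (Rminus u x))).
    by apply: Rmult_le_compat_r => //; apply: Rabs_pos.
  have : Rlt (Rabs (Rminus u x)) (e / 2 / M) by lra.
  by move=> /(Rlt_div_r _ _ _ M_gt0); rewrite Rmult_comm.
rewrite -/(F u v) -/(F x t).
have -> : Rminus (F u v) (F x t) =
    Rplus (Rmult (g c v) (Rminus u x)) (Rminus (F x v) (F x t)).
  by rewrite -ec /=; lra.
by apply: Rle_lt_trans (Rabs_triang _ _) _; lra.
Qed.

(** * Energy estimate and uniqueness for a linear third-order equation *)

Lemma gronwall (z z' : R -> R) (K a b : R) :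
  (forall t, Rmin a b <= t <= Rmax a b ->
     is_derive z t (z' t) /\ Rabs (z' t) <= K * z t) ->
  z b <= z a * exp (K * Rabs (b - a)).
Proof.
move=> Hz.
(* Monotonicity of [z t * exp (s * t)] from [a] to [b]. Forwards in time [s = - K] is used,
   backwards [s = K]. *)
have main s : (forall t, Rmin a b <= t <= Rmax a b ->
    (z' t + s * z t) * (b - a) <= 0) -> z b <= z a * exp (s * (a - b)).
  move=> hs.
  have dz t : Rmin a b <= t <= Rmax a b ->
      is_derive (fun t => z t * exp (s * t)) t ((z' t + s * z t) * exp (s * t)).
    move=> /Hz[hz _]; auto_derive; first by (try split => //); exists (z' t).
    by rewrite (is_derive_unique _ _ _ hz); ring.
  have [||c [hc eqc]] := MVT_gen (fun t => z t * exp (s * t)) a b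
    (fun t => (z' t + s * z t) * exp (s * t)).
  - by move=> t ht; apply: dz; lra.
  - move=> t /dz h; apply: derivable_continuous_pt; apply: ex_derive_Reals_0.
    by eexists; exact: h.
  have ec := exp_pos (s * c); have eb := exp_pos (- (s * b)).
  have h : z b * exp (s * b) <= z a * exp (s * a).
    by have := hs c hc; move: eqc => /= eqc h; nra.
  have -> : z b = z b * exp (s * b) * exp (- (s * b)).
    by rewrite Rmult_assoc -exp_plus Rplus_opp_r exp_0 Rmult_1_r.
  have -> : z a * exp (s * (a - b)) = z a * exp (s * a) * exp (- (s * b)).
    by rewrite Rmult_assoc -exp_plus; congr (_ * exp _); ring.
  by apply: Rmult_le_compat_r => //; lra.
case: (Rle_dec a b) => ab.
  rewrite Rabs_pos_eq; last lra.
  have -> : K * (b - a) = - K * (a - b) by ring.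
  by apply: main => t /Hz[_ /Rabs_le_between]; nra.
rewrite Rabs_left; last lra.
have -> : K * - (b - a) = K * (a - b) by ring.
by apply: main => t /Hz[_ /Rabs_le_between]; nra.
Qed.

Lemma Rabs_mult_le (a b A B : R) :
  Rabs a <= A -> Rabs b <= B -> Rabs (a * b) <= A * B.
Proof.
by move=> ha hb; rewrite Rabs_mult; apply: Rmult_le_compat => //; apply: Rabs_pos.
Qed.

(** Pointwise estimate of [remainder], with [p = e * x] and [u] the cutoff. Terms linear in [e] also
    carry the factor [u * w], and [e * (u * w)] is at most half of [(u * w) ^ 2 + e ^ 2]; the term
    without [u] is already of order [e ^ 2]. So everything is controlled by the density plus
    [e ^ 2]. *)
Lemma energy_remainder_bound (e p u w w1 w2 b b1 c C : R) :
  0 <= e -> -1 <= p <= 1 -> Rabs w <= C -> Rabs w1 <= C -> Rabs w2 <= C ->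
  Rabs b <= C -> Rabs b1 <= C -> Rabs c <= C ->
  Rabs (3 * e * p * u * w * w2 + (e ^ 2 - 3 * e ^ 2 * p ^ 2) * w * w1
     + 4 * e * p * u * b * w ^ 2 - u ^ 2 * b1 * w ^ 2 + 2 * c * u ^ 2 * w ^ 2) <=
  (6 * C + 4 * C ^ 2) * ((u * w) ^ 2 + e ^ 2).
Proof.
move=> e0 hp hw hw1 hw2 hb hb1 hc.
pose Z := (u * w) ^ 2 + e ^ 2.
have C0 : 0 <= C by have := Rabs_pos w; lra.
have hpa : Rabs p <= 1 by apply: Rabs_le.
have hez : Rabs (e * (u * w)) <= Z / 2 
  by apply: Rabs_le; rewrite /Z; have := pow2_ge_0 (e - u * w); have := pow2_ge_0 (e + u * w); lra.
have he2 : Rabs (e ^ 2 * (1 - 3 * p ^ 2)) <= 2 * Z.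
  have he : Rabs (e ^ 2) <= Z.
    by rewrite Rabs_pos_eq /Z; have := pow2_ge_0 e; have := pow2_ge_0 (u * w); lra.
  rewrite Rmult_comm; apply: Rabs_mult_le he; apply: Rabs_le; nra.
have hz2 : Rabs ((u * w) ^ 2) <= Z.
  by rewrite Rabs_pos_eq /Z; have := pow2_ge_0 e; have := pow2_ge_0 (u * w); lra.
have t1 := Rabs_mult_le (Rabs_mult_le hpa hw2) hez.
have t2 := Rabs_mult_le (Rabs_mult_le hw hw1) he2.
have t3 := Rabs_mult_le (Rabs_mult_le hpa (Rabs_mult_le hb hw)) hez.
have t4 := Rabs_mult_le hb1 hz2.
have t5 := Rabs_mult_le hc hz2.
rewrite -/Z.
have -> : 3 * e * p * u * w * w2 + (e ^ 2 - 3 * e ^ 2 * p ^ 2) * w * w1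
     + 4 * e * p * u * b * w ^ 2 - u ^ 2 * b1 * w ^ 2 + 2 * c * u ^ 2 * w ^ 2 =
  3 * (p * w2 * (e * (u * w))) + w * w1 * (e ^ 2 * (1 - 3 * p ^ 2))
   + 4 * (p * (b * w) * (e * (u * w))) - b1 * (u * w) ^ 2 + 2 * (c * (u * w) ^ 2).
  by ring.
by move: t1 t2 t3 t4 t5 => /Rabs_le_between ? /Rabs_le_between ?
  /Rabs_le_between ? /Rabs_le_between ? /Rabs_le_between ?; apply: Rabs_le; nra.
Qed.

Section Uniqueness.
Variables (w b : R -> R -> R) (c : R -> R) (t0 : R).
Hypotheses (sw : smooth2 w) (sb : smooth2 b).
Hypothesis weq : forall x t,
  Dt w x t = / 4 * Dx (Dx (Dx w)) x t + b x t * Dx w x t + c t * w x t.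
Hypothesis bounded : forall T, exists C, forall x t, Rabs t <= T ->
  Rabs (w x t) <= C /\ Rabs (Dx w x t) <= C /\ Rabs (Dx (Dx w) x t) <= C /\
  Rabs (b x t) <= C /\ Rabs (Dx b x t) <= C /\ Rabs (c t) <= C.
Hypothesis w0 : forall x, w x t0 = 0.

(* [flux] collects the boundary terms of the integrations by parts in the time
   derivative of the energy; it is divisible by [cutoff], and [remainder] contains no
   [Dx w ^ 2]. *)
Let cutoff (e x : R) := 1 - (e * x) ^ 2.
Let density (e x t : R) := (cutoff e x * w x t) ^ 2.
Let flux (e x t : R) :=
  / 2 * (cutoff e x ^ 2 * w x t * Dx (Dx w) x t
         - cutoff e x ^ 2 * Dx w x t ^ 2 / 2
         - 2 * e ^ 2 * x * cutoff e x * w x t * Dx w x t)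
  + cutoff e x ^ 2 * b x t * w x t ^ 2.
Let remainder (e x t : R) :=
  3 * e * (e * x) * cutoff e x * w x t * Dx (Dx w) x t
  + (e ^ 2 - 3 * e ^ 2 * (e * x) ^ 2) * w x t * Dx w x t
  + 4 * e * (e * x) * cutoff e x * b x t * w x t ^ 2
  - cutoff e x ^ 2 * Dx b x t * w x t ^ 2
  + 2 * c t * cutoff e x ^ 2 * w x t ^ 2.

Lemma smooth2_cutoff e : smooth2 (fun x _ => cutoff e x).
Proof.
rewrite /cutoff /=; apply: (smooth2D (smooth2_cst 1)); apply: smooth2N.
apply: (@smooth2M (fun x _ => e * x)); last first.
  apply: (@smooth2M (fun x _ => e * x)); last exact: smooth2_cst.
  exact: (smooth2M (smooth2_cst e) smooth2_fst).
exact: (smooth2M (smooth2_cst e) smooth2_fst).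
Qed.

Lemma smooth2_density e : smooth2 (density e).
Proof.
have s : smooth2 (fun x t => cutoff e x * w x t).
  exact: (smooth2M (smooth2_cutoff e) sw).
apply: (@smooth2M (fun x t => cutoff e x * w x t)) => //.
by apply: (@smooth2M (fun x t => cutoff e x * w x t)) => //; apply: smooth2_cst.
Qed.

(** The usual two integrations by parts of [w w'''] leave [w' ^ 2] times the derivative of the
    squared cutoff. The last term of the first bracket of [flux] is chosen to cancel it, trading it
    for [w w''] and [w w'], which are bounded by hypothesis. *)
Lemma density_balance e x t :
  is_derive (fun x => flux e x t) x (Dt (density e) x t - remainder e x t).
Proof.
have dw := smooth2_derx x t sw; have dw1 := smooth2_derx x t (smooth2_Dx sw).
have dw2 := smooth2_derx x t (smooth2_Dx (smooth2_Dx sw)).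
have db := smooth2_derx x t sb; have dtw := smooth2_dert x t sw.
have -> : Dt (density e) x t = 2 * cutoff e x ^ 2 * w x t * Dt w x t.
  apply: is_derive_unique; rewrite /density.
  auto_derive; first by eexists; exact: dtw.
  by rewrite (is_derive_unique _ _ _ dtw); ring.
rewrite /flux /remainder weq /cutoff; auto_derive.
  by repeat split; eexists; eassumption.
rewrite (is_derive_unique _ _ _ dw) (is_derive_unique _ _ _ dw1).
by rewrite (is_derive_unique _ _ _ dw2) (is_derive_unique _ _ _ db); field.
Qed.


Lemma smooth2_flux e : smooth2 (flux e).
Proof.
have s2 f : smooth2 f -> smooth2 (fun x t => f x t ^ 2).
  move=> sf; apply: (smooth2M sf); apply: (smooth2M sf).
  exact: smooth2_cst.
have sc := smooth2_cutoff e; have sw1 := smooth2_Dx sw.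
have sw2 := smooth2_Dx sw1.
apply: smooth2D; last by apply: smooth2M; [apply: smooth2M => //; apply: s2|apply: s2].
apply: (smooth2M (smooth2_cst _)); apply: smooth2D.
  apply: smooth2D; first by do 2!apply: smooth2M => //; apply: s2.
  apply: smooth2N; apply: (@smooth2M _ (fun=> fun=> / 2)); last exact: smooth2_cst.
  by apply: smooth2M; apply: s2.
apply: smooth2N; do 3!apply: smooth2M => //.
by apply: smooth2M; [exact: smooth2_cst | exact: smooth2_fst].
Qed.

Lemma Dx_flux e x t : Dx (flux e) x t = Dt (density e) x t - remainder e x t.
Proof. exact: is_derive_unique (density_balance e x t). Qed.

(** By the balance law the remainder is a difference of two functions already known to be smooth. *)
Lemma ex_RInt_remainder e p q t : ex_RInt (fun x => remainder e x t) p q.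
Proof.
apply: (ex_RInt_ext (fun x => Dt (density e) x t - Dx (flux e) x t)).
  move=> x _; suff : Dt (density e) x t - Dx (flux e) x t = remainder e x t by [].
  by rewrite Dx_flux; ring.
apply: (ex_RInt_minus (V := R_NormedModule)); apply: smooth2_ex_RInt.
  exact: smooth2_Dt (smooth2_density e).
exact: smooth2_Dx (smooth2_flux e).
Qed.

(** The polynomial cutoff is not truncated: the integral stops at its zeros [- / e] and [/ e], where
    the flux vanishes with it, so no boundary term survives. *)
Lemma energy_derivative e t : 0 < e ->
  is_derive (fun t => RInt (fun x => density e x t) (- / e) (/ e)) t
    (RInt (fun x => remainder e x t) (- / e) (/ e)).
Proof.
move=> e0; have hd := smooth2_RInt_dert (- / e) (/ e) t (smooth2_density e).
have fl0 s : s = / e \/ s = - / e -> flux e s t = 0.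
  move=> hs; have cs : cutoff e s = 0.
    by rewrite /cutoff; case: hs => ->; field; lra.
  by rewrite /flux cs; field.
suff <- : RInt (fun x => Dt (density e) x t) (- / e) (/ e) =
    RInt (fun x => remainder e x t) (- / e) (/ e) by [].
have hflux : is_RInt (Dx (flux e) ^~ t) (- / e) (/ e)
    (minus (flux e (/ e) t) (flux e (- / e) t)).
  apply: (is_RInt_derive (fun x => flux e x t)) => x _.
    exact: smooth2_derx (smooth2_flux e).
  exact: smooth2_contx (smooth2_Dx (smooth2_flux e)).
have := is_RInt_unique _ _ _ _ hflux.
rewrite (fl0 (/ e)); last by left.
rewrite (fl0 (- / e)); last by right.
rewrite (RInt_ext _ (fun x => minus (Dt (density e) x t) (remainder e x t))); last first.
  by move=> x _; rewrite Dx_flux.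
rewrite RInt_minus; last exact: ex_RInt_remainder.
  by rewrite /minus /plus /Hierarchy.opp /= => h; lra.
exact: smooth2_ex_RInt (smooth2_Dt (smooth2_density e)).
Qed.

Lemma density_ge0 e x t : 0 <= density e x t.
Proof. exact: pow2_ge_0. Qed.

(** The constant [e ^ 2] of the pointwise estimate, integrated over an interval of length [2 / e],
    contributes [2 * e]. Hence [E + 2 * e] satisfies the Gronwall inequality and equals [2 * e] at
    [t0]; the bound tends to 0 as the cutoff widens. *)
Lemma energy_bound t : exists M, forall e, 0 < e ->
  RInt (fun x => density e x t) (- / e) (/ e) <= M * e.
Proof.
pose T := Rmax (Rabs t0) (Rabs t).
have [C hC] := bounded T.
have C0 : 0 <= C by have := hC 0 t (Rmax_r _ _); have := Rabs_pos (w 0 t); lra.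
pose K := 6 * C + 4 * C ^ 2.
have K0 : 0 <= K by rewrite /K; have := pow2_ge_0 C; lra.
exists (2 * exp (K * Rabs (t - t0))) => e e0.
have ei := Rinv_0_lt_compat e e0.
pose E s := RInt (fun x => density e x s) (- / e) (/ e).
have E0 : E t0 = 0.
  rewrite /E (RInt_ext _ (fun=> 0)).
    by rewrite RInt_const /scal /= /mult /=; ring.
  move=> x _; suff : density e x t0 = 0 by [].
  by rewrite /density w0; ring.
have dE s : Rmin t0 t <= s <= Rmax t0 t ->
    is_derive (fun s => E s + 2 * e) s (RInt (fun x => remainder e x s) (- / e) (/ e))
    /\ Rabs (RInt (fun x => remainder e x s) (- / e) (/ e)) <= K * (E s + 2 * e).
  move=> hs; split.
    rewrite -[RInt _ _ _]Rplus_0_r; apply: (is_derive_plus (V := R_NormedModule)).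
      exact: energy_derivative.
    exact: is_derive_const.
  have hsT : Rabs s <= T.
    move: hs; rewrite /T /Rmin /Rmax /Rabs.
    by case: Rle_dec => ?; do 3!case: Rcase_abs => ?; case: Rle_dec => ?; lra.
  have exd := smooth2_ex_RInt (- / e) (/ e) s (smooth2_density e).
  have exb : ex_RInt (fun x => K * (density e x s + e ^ 2)) (- / e) (/ e).
    apply: (ex_RInt_scal (V := R_NormedModule) (fun x => density e x s + e ^ 2)).
    apply: (ex_RInt_plus (V := R_NormedModule)) => //; exact: ex_RInt_const.
  have -> : K * (E s + 2 * e) =
      RInt (fun x => K * (density e x s + e ^ 2)) (- / e) (/ e).
    rewrite (RInt_scal (V := R_CompleteNormedModule) (fun x => density e x s + e ^ 2));
      last first.
      apply: (ex_RInt_plus (V := R_NormedModule)) => //; exact: ex_RInt_const.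
    rewrite (RInt_plus (V := R_CompleteNormedModule)) //; last exact: ex_RInt_const.
    rewrite RInt_const /scal /= /mult /= /plus /= -/(E s); field; lra.
  apply: (Rle_trans _ (RInt (fun x => Rabs (remainder e x s)) (- / e) (/ e))).
    by apply: abs_RInt_le; [lra | apply: ex_RInt_remainder].
  apply: RInt_le => //; first lra.
    by apply: ex_RInt_norm; apply: ex_RInt_remainder.
  move=> x hx; have [? [? [? [? [? ?]]]]] := hC x s hsT.
  apply: (@energy_remainder_bound e (e * x)) => //; first lra.
  have := Rmult_lt_compat_l e _ _ e0 hx.1; have := Rmult_lt_compat_l e _ _ e0 hx.2.
  by rewrite Ropp_mult_distr_r_reverse Rinv_r; lra.
have := gronwall dE.
rewrite E0 -/(E t) Rplus_0_l.
have -> : 2 * exp (K * Rabs (t - t0)) * e = 2 * e * exp (K * Rabs (t - t0)) by ring.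
lra.
Qed.

Lemma RInt_sqr_eq0 p q t : p <= q -> RInt (fun x => w x t ^ 2) p q <= 0.
Proof.
move=> pq; have [M hM] := energy_bound t.
have sw2 : smooth2 (fun x t => w x t ^ 2).
  by apply: (smooth2M sw); apply: (smooth2M sw); exact: smooth2_cst.
(* For [e < / m] the interval from [p] to [q] lies in the support, and [e * x] is at most [/ 2]
   there in absolute value. The cutoff is then at least [3 / 4], so its square exceeds [/ 4]. *)
pose m := 2 * (1 + Rabs p + Rabs q).
have [? ?] := (Rabs_pos p, Rabs_pos q).
have m0 : 0 < m by rewrite /m; lra.
have hlim e : 0 < e < / m -> RInt (fun x => w x t ^ 2) p q <= 4 * M * e.
  move=> he; have me : m * e <= 1.
    by have := Rmult_lt_compat_l m _ _ m0 he.2; rewrite Rinv_r; lra.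
  have hin x : p <= x <= q -> Rabs (e * x) <= / 2.
    move=> hx; have hxa : Rabs x <= m / 2.
      by rewrite /m; move: hx; rewrite /Rabs; do 3!case: Rcase_abs => ?; lra.
    by rewrite Rabs_mult (Rabs_pos_eq e); [nra | lra].
  have ei : - / e <= p /\ q <= / e.
    have hie : m <= / e.
      rewrite -(Rinv_inv m); apply: Rinv_le_contravar; lra.
    by move: hie; rewrite /m /Rabs; do 2!case: Rcase_abs => ?; lra.
  have ex u v := smooth2_ex_RInt u v t (smooth2_density e).
  have h1 : RInt (fun x => density e x t) p q <= RInt (fun x => density e x t) (- / e) (/ e).
    rewrite -(RInt_Chasles _ (- / e) p (/ e)) // -(RInt_Chasles _ p q (/ e)) //.
    have := RInt_ge_0 _ _ _ ei.1 (ex _ _) (fun x _ => density_ge0 e x t).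
    have := RInt_ge_0 _ _ _ ei.2 (ex _ _) (fun x _ => density_ge0 e x t).
    by rewrite /plus /=; lra.
  have h2 : RInt (fun x => / 4 * w x t ^ 2) p q <= RInt (fun x => density e x t) p q.
    apply: RInt_le => //.
      apply: (ex_RInt_scal (V := R_NormedModule) (fun x => w x t ^ 2)).
      exact: (smooth2_ex_RInt p q t sw2).
    move=> x hx; have /Rabs_le_between hx2 : Rabs (e * x) <= / 2 by apply: hin; lra.
    rewrite /density /cutoff Rpow_mult_distr.
    apply: Rmult_le_compat_r; first exact: pow2_ge_0.
    have h : 3 / 4 <= 1 - (e * x) ^ 2 by nra.
    by nra.
  move: h2; rewrite (RInt_scal (V := R_CompleteNormedModule) (fun x => w x t ^ 2)); last first.
    exact: (smooth2_ex_RInt p q t sw2).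
  by have := hM e he.1; rewrite /scal /= /mult /=; lra.
apply: Rnot_lt_le => I0.
pose I := RInt (fun x => w x t ^ 2) p q.
have im := Rinv_0_lt_compat m m0.
have Ma : 0 <= Rabs M by apply: Rabs_pos.
(* With this [e] the bound [4 * M * e] is at most half of the integral [I], which contradicts
   [0 < I]. *)
pose e := Rmin (/ m / 2) (I / (8 * (Rabs M + 1))).
have e0 : 0 < e.
  by apply: Rmin_pos; [lra | apply: Rdiv_lt_0_compat => //; lra].
have := hlim e; have := Rmin_l (/ m / 2) (I / (8 * (Rabs M + 1))).
have := Rmin_r (/ m / 2) (I / (8 * (Rabs M + 1))); rewrite -/e -/I => e1 e2.
have e3 : 8 * (Rabs M + 1) * e <= I.
  have := Rmult_le_compat_l (8 * (Rabs M + 1)) _ _ ltac:(lra) e1.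
  by have -> : 8 * (Rabs M + 1) * (I / (8 * (Rabs M + 1))) = I by field; lra.
have hMa := Rle_abs M; have em : e < / m by lra.
move=> /(_ (conj e0 em)).
by rewrite -/I in I0 *; nra.
Qed.

Lemma third_order_uniqueness x t : w x t = 0.
Proof.
have sw2 : smooth2 (fun x t => w x t ^ 2).
  by apply: (smooth2M sw); apply: (smooth2M sw); exact: smooth2_cst.
have d := smooth2_RInt_derx (x - 1) x t sw2.
(* The integral from [x - 1] vanishes for every endpoint near [x], so its derivative at [x], which
   is [w x t ^ 2], is 0. *)
have d0 : is_derive (fun y => RInt (fun x => w x t ^ 2) (x - 1) y) x 0.
  apply: (is_derive_ext_loc (fun=> 0)); last exact: is_derive_const.
  exists (mkposreal 1 Rlt_0_1) => y /Rabs_lt_between /= hy.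
  have hy1 : x - 1 <= y by move: hy; rewrite /minus /plus /Hierarchy.opp /=; lra.
  apply: Rle_antisym; last exact: RInt_sqr_eq0.
  apply: RInt_ge_0 => //; last by move=> ? _; apply: pow2_ge_0.
  exact: (smooth2_ex_RInt (x - 1) y t sw2).
have := is_derive_unique _ _ _ d; rewrite (is_derive_unique _ _ _ d0).
by move=> h; apply: Rsqr_0_uniq; rewrite /Rsqr; lra.
Qed.

End Uniqueness.

End RealAnalysis.

From mathcomp Require Import ring lra.

(** * Null frames *)

Lemma big_ord3 (F : 'I_3 -> R) : \sum_i F i = F 0 + F 1 + F 2.
Proof.
rewrite !big_ord_recl big_ord0 addr0 addrA.
by congr (F _ + F _ + F _); apply: val_inj.
Qed.

Lemma ord3_ind (P : 'I_3 -> Prop) : P 0 -> P 1 -> P 2 -> forall i, P i.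
Proof.
move=> P0 P1 P2 [[|[|[|//]]] lti].
- by rewrite (_ : Ordinal lti = 0) //; apply: val_inj.
- by rewrite (_ : Ordinal lti = 1) //; apply: val_inj.
- by rewrite (_ : Ordinal lti = 2) //; apply: val_inj.
Qed.

Lemma innerE v w :
  inner v w = v 0 0 * w 0 0 + 2^-1 * (v 1 0 * w 2 0 + v 2 0 * w 1 0).
Proof. by rewrite /inner !(mxE, big_ord3) /=; ring. Qed.

Lemma innerC v w : inner v w = inner w v.
Proof. by rewrite !innerE; ring. Qed.

Lemma innerDl u v w : inner (u + v) w = inner u w + inner v w.
Proof. by rewrite !innerE !mxE; ring. Qed.

Lemma innerDr u v w : inner w (u + v) = inner w u + inner w v.
Proof. by rewrite !innerE !mxE; ring. Qed.

Lemma innerZl a v w : inner (a *: v) w = a * inner v w.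
Proof. by rewrite !innerE !mxE; ring. Qed.

Lemma innerZr a v w : inner w (a *: v) = a * inner w v.
Proof. by rewrite !innerE !mxE; ring. Qed.

Lemma innerNl v w : inner (- v) w = - inner v w.
Proof. by rewrite !innerE !mxE; ring. Qed.

Lemma innerNr v w : inner w (- v) = - inner w v.
Proof. by rewrite !innerE !mxE; ring. Qed.

Definition innerL := (innerDl, innerDr, innerZl, innerZr, innerNl, innerNr).

Record null_triple (e0 e1 e2 : 'cV[R]_3) : Prop := {
  nt00 : inner e0 e0 = 1; nt01 : inner e0 e1 = 0; nt02 : inner e0 e2 = 0;
  nt11 : inner e1 e1 = 0; nt12 : inner e1 e2 = 2^-1; nt22 : inner e2 e2 = 0 }.

Lemma nt10 e0 e1 e2 : null_triple e0 e1 e2 -> inner e1 e0 = 0.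
Proof. by rewrite innerC; apply: nt01. Qed.

Lemma nt20 e0 e1 e2 : null_triple e0 e1 e2 -> inner e2 e0 = 0.
Proof. by rewrite innerC; apply: nt02. Qed.

Lemma nt21 e0 e1 e2 : null_triple e0 e1 e2 -> inner e2 e1 = 2^-1.
Proof. by rewrite innerC; apply: nt12. Qed.

Definition cols (e0 e1 e2 : 'cV[R]_3) : 'M[R]_3 :=
  \matrix_(i, j) (nth 0 [:: e0; e1; e2] j) i 0.

Lemma col0_cols e0 e1 e2 : col 0 (cols e0 e1 e2) = e0.
Proof. by apply/matrixP => i j; rewrite !mxE (ord1 j). Qed.

Lemma col1_cols e0 e1 e2 : col 1 (cols e0 e1 e2) = e1.
Proof. by apply/matrixP => i j; rewrite !mxE (ord1 j). Qed.

Lemma col2_cols e0 e1 e2 : col 2 (cols e0 e1 e2) = e2.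
Proof. by apply/matrixP => i j; rewrite !mxE (ord1 j). Qed.

Lemma inner_col (A : 'M[R]_3) i j : inner (col i A) (col j A) = (A^T *m D3 *m A) i j.
Proof.
rewrite innerE !(mxE, big_ord3) /=; do ?[rewrite !mxE /=]; ring.
Qed.

Lemma D3_unit : D3 \in unitmx.
Proof.
suff : mx3 [:: [:: 1; 0; 0]; [:: 0; 0; 2]; [:: 0; 2; 0]] *m D3 = 1%:M.
  by move=> /mulmx1_unit[].
apply/matrixP => i j; rewrite !(mxE, big_ord3) /=.
move: i j; apply: ord3_ind; apply: ord3_ind => /=; by rewrite ?mulr1n ?mulr0n; field.
Qed.

Lemma O3D3P (A : 'M[R]_3) : O3D3 A <-> null_triple (col 0 A) (col 1 A) (col 2 A).
Proof.
split=> [[_ AD]|[h00 h01 h02 h11 h12 h22]].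
  by split; rewrite inner_col AD !mxE.
have AD : A^T *m D3 *m A = D3.
  apply/matrixP; apply: ord3_ind; apply: ord3_ind; rewrite -inner_col;
  by rewrite ?(h00, h01, h02, h11, h12, h22) 1?innerC ?(h00, h01, h02, h11, h12, h22) !mxE.
split=> //; suff /mulmx1_unit[_ ->] : (invmx D3 *m A^T *m D3) *m A = 1%:M by [].
by rewrite -!mulmxA (mulmxA A^T) AD mulVmx // D3_unit.
Qed.

(** The null vectors are dual to each other up to the factor [<e1, e2> = 1/2]; hence the 2, and the
    pairing with the opposite null vector. *)
Lemma null_triple_decomp e0 e1 e2 v : null_triple e0 e1 e2 ->
  v = inner v e0 *: e0 + (2 * inner v e2) *: e1 + (2 * inner v e1) *: e2.
Proof.
move=> nt; pose A := cols e0 e1 e2.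
have cA : col 0 A = e0 /\ col 1 A = e1 /\ col 2 A = e2.
  by rewrite col0_cols col1_cols col2_cols.
have [c0 [c1 c2]] := cA.
have [uA _] : O3D3 A by apply/O3D3P; rewrite c0 c1 c2.
pose y := invmx A *m v.
have vE : v = y 0 0 *: e0 + y 1 0 *: e1 + y 2 0 *: e2.
  have {1}-> : v = A *m y by rewrite mulmxA mulmxV // mul1mx.
  apply/matrixP => i j; rewrite (ord1 j) -c0 -c1 -c2.
  by rewrite !(mxE, big_ord3); ring.
rewrite vE !innerL (nt00 nt) (nt01 nt) (nt02 nt) (nt11 nt) (nt12 nt) (nt22 nt).
rewrite (nt10 nt) (nt20 nt) (nt21 nt).
by apply/matrixP => i j; rewrite !mxE; field.
Qed.

(** * Entrywise calculus of matrix-valued functions *)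

Definition is_dmx m n (f : R -> 'M[R]_(m, n)) (x : R) (df : 'M[R]_(m, n)) : Prop :=
  forall i j, is_derive (fun y => f y i j) x (df i j).

Section DMX.
Variables (m n : nat).
Implicit Types f h : R -> 'M[R]_(m, n).

Lemma is_dmx_unique f x df : is_dmx f x df -> Dmx f x = df.
Proof. by move=> d; apply/matrixP => i j; rewrite mxE; apply: is_derive_unique. Qed.

Lemma is_dmx_eq f x df df' : is_dmx f x df -> df = df' -> is_dmx f x df'.
Proof. by move=> ? <-. Qed.

Lemma smooth_is_dmx f x : smooth_mx f -> is_dmx f x (Dmx f x).
Proof.
by move=> sf i j; rewrite mxE; apply: Derive_correct; apply: smooth_ex_derive.
Qed.

Lemma is_dmxD f h x df dh : is_dmx f x df -> is_dmx h x dh ->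
  is_dmx (fun y => f y + h y) x (df + dh).
Proof.
move=> fx hx i j; rewrite mxE; apply: (is_derive_ext (fun y => f y i j + h y i j)).
  by move=> y; rewrite mxE.
exact: is_deriveD.
Qed.

Lemma is_dmx_cst A x : is_dmx (fun=> A) x (0 : 'M[R]_(m, n)).
Proof. by move=> i j; rewrite mxE; apply: is_derive_cst. Qed.

Lemma is_dmxZ (k : R -> R) f x dk df : is_derive k x dk -> is_dmx f x df ->
  is_dmx (fun y => k y *: f y) x (dk *: f x + k x *: df).
Proof.
move=> kx fx i j; rewrite !mxE; apply: (is_derive_ext (fun y => k y * f y i j)).
  by move=> y; rewrite mxE.
exact: is_deriveM.
Qed.

Lemma is_dmx_comp f (p : R -> R) x dp df : is_derive p x dp -> is_dmx f (p x) df ->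
  is_dmx (fun y => f (p y)) x (dp *: df).
Proof.
move=> px fx i j; rewrite mxE.
exact: (is_derive_comp1 (f := fun y => f y i j)).
Qed.

Lemma is_dmx_uniq f x df df' : is_dmx f x df -> is_dmx f x df' -> df = df'.
Proof. by move=> /is_dmx_unique <- /is_dmx_unique. Qed.

Lemma is_dmx_ext f h x df : (forall y, f y = h y) -> is_dmx f x df -> is_dmx h x df.
Proof. by move=> fh fx i j; apply: is_derive_ext (fx i j) => y; rewrite fh. Qed.

End DMX.

Lemma is_derive_inner (u v : R -> 'cV[R]_3) x du dv :
  is_dmx u x du -> is_dmx v x dv ->
  is_derive (fun y => inner (u y) (v y)) x (inner du (v x) + inner (u x) dv).
Proof.
move=> ux vx; apply: (is_derive_ext (fun y => u y 0 0 * v y 0 0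
    + 2^-1 * (u y 1 0 * v y 2 0 + u y 2 0 * v y 1 0))).
  by move=> y; rewrite innerE.
apply: is_derive_eq.
  apply: is_deriveD; first by apply: is_deriveM; [apply: ux | apply: vx].
  apply: is_deriveM; first exact: is_derive_cst.
  by apply: is_deriveD; apply: is_deriveM; try apply: ux; apply: vx.
by rewrite !innerE; ring.
Qed.

(** Working form of the definition, free of [invmx]: orthogonality becomes the Gram relations of the
    columns, and the frame equation becomes their structure equations. *)
Lemma null_p_frameP c g k1 k2 : null_p_frame c g k1 k2 <->
  [/\ smooth_mx g, forall x, null_triple (col 0 (g x)) (col 1 (g x)) (col 2 (g x)),
      forall x, Dmx c x = col 0 (g x) &
      forall x, [/\ is_dmx (fun y => col 0 (g y)) x (k1 x *: col 1 (g x) + k2 x *: col 2 (g x)),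
        is_dmx (fun y => col 1 (g y)) x (- (k2 x / 2) *: col 0 (g x)) &
        is_dmx (fun y => col 2 (g y)) x (- (k1 x / 2) *: col 0 (g x))]].
Proof.
have colE (A : 'M[R]_3) (a b : R) j : col j (A *m frame_mx a b) =
    frame_mx a b 0 j *: col 0 A + frame_mx a b 1 j *: col 1 A
    + frame_mx a b 2 j *: col 2 A.
  by apply/matrixP => i l; rewrite !(mxE, big_ord3) /=; ring.
have col0E (A : 'M[R]_3) (a b : R) :
    col 0 (A *m frame_mx a b) = a *: col 1 A + b *: col 2 A.
  by rewrite colE !mxE /= scale0r add0r.
have col1E (A : 'M[R]_3) (a b : R) :
    col 1 (A *m frame_mx a b) = - (b / 2) *: col 0 A.
  by rewrite colE !mxE /= !scale0r !addr0.
have col2E (A : 'M[R]_3) (a b : R) :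
    col 2 (A *m frame_mx a b) = - (a / 2) *: col 0 A.
  by rewrite colE !mxE /= !scale0r !addr0.
split=> [[sg Og tg eqg]|[sg nt tg eqg]].
  split=> // [x|x]; first exact/O3D3P.
  have dg : Dmx g x = g x *m frame_mx (k1 x) (k2 x).
    by rewrite -eqg mulmxA mulmxV ?mul1mx //; case: (Og x).
  have dcol j : is_dmx (fun y => col j (g y)) x (col j (g x *m frame_mx (k1 x) (k2 x))).
    move=> i l; rewrite -dg mxE; apply: is_derive_ext (smooth_is_dmx x sg i j) => y.
    by rewrite mxE.
  split; first by rewrite -(col0E (g x) (k1 x) (k2 x)).
    by rewrite -(col1E (g x) (k1 x) (k2 x)).
  by rewrite -(col2E (g x) (k1 x) (k2 x)).
have Og x : O3D3 (g x) by apply/O3D3P.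
split=> // x; have [d0 d1 d2] := eqg x.
have -> : Dmx g x = g x *m frame_mx (k1 x) (k2 x).
  have dcol j : col j (Dmx g x) = Dmx (fun y => col j (g y)) x.
    apply/matrixP => i l; rewrite !mxE; apply: Derive_ext => y; by rewrite mxE.
  have Dg j : col j (Dmx g x) = col j (g x *m frame_mx (k1 x) (k2 x)).
    rewrite dcol; apply: is_dmx_unique; move: j.
    by apply: ord3_ind; rewrite (col0E, col1E, col2E).
  apply/matrixP => i j; have /matrixP/(_ i 0) := Dg j; by rewrite mxE [in RHS]mxE.
by rewrite mulmxA mulVmx ?mul1mx //; case: (Og x).
Qed.

Definition dxm m n (f : R -> R -> 'M[R]_(m, n)) (x t : R) : 'M[R]_(m, n) :=
  Dmx (fun y => f y t) x.
Definition dtm m n (f : R -> R -> 'M[R]_(m, n)) (x t : R) : 'M[R]_(m, n) :=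
  Dmx (f x) t.

Section Smooth2Mx.
Variables (m n : nat).
Implicit Types f h : R -> R -> 'M[R]_(m, n).

Lemma smooth2_mxE f (F : 'I_m -> 'I_n -> R -> R -> R) :
  (forall i j x t, f x t i j = F i j x t) -> (forall i j, smooth2 (F i j)) ->
  smooth2_mx f.
Proof.
move=> fF sF i j; rewrite (_ : (fun x t => _) = F i j) //.
by do 2!apply: functional_extensionality => ?; apply: fF.
Qed.

Lemma smooth2_mxD f h : smooth2_mx f -> smooth2_mx h ->
  smooth2_mx (fun x t => f x t + h x t).
Proof.
move=> sf sh; apply: (smooth2_mxE (F := fun i j x t => f x t i j + h x t i j)).
  by move=> *; rewrite mxE.
by move=> i j; apply: smooth2D.
Qed.

Lemma smooth2_mxZ k f : smooth2 k -> smooth2_mx f ->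
  smooth2_mx (fun x t => k x t *: f x t).
Proof.
move=> sk sf; apply: (smooth2_mxE (F := fun i j x t => k x t * f x t i j)).
  by move=> *; rewrite mxE.
by move=> i j; apply: smooth2M.
Qed.

Lemma smooth2_mx_cst A : smooth2_mx (fun _ _ => A : 'M[R]_(m, n)).
Proof. by move=> i j; apply: smooth2_cst. Qed.

Lemma smooth2_dxm f : smooth2_mx f -> smooth2_mx (dxm f).
Proof.
move=> sf; apply: (smooth2_mxE (F := fun i j => Dx (fun x t => f x t i j))).
  by move=> *; rewrite mxE.
by move=> i j; apply: smooth2_Dx.
Qed.

Lemma smooth2_dtm f : smooth2_mx f -> smooth2_mx (dtm f).
Proof.
move=> sf; apply: (smooth2_mxE (F := fun i j => Dt (fun x t => f x t i j))).
  by move=> *; rewrite mxE.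
by move=> i j; apply: smooth2_Dt.
Qed.

Lemma smooth2_is_dmx f x t : smooth2_mx f -> is_dmx (fun y => f y t) x (dxm f x t).
Proof. by move=> sf i j; rewrite mxE; apply: (smooth2_derx x t (sf i j)). Qed.

Lemma smooth2_is_dmxt f x t : smooth2_mx f -> is_dmx (f x) t (dtm f x t).
Proof. by move=> sf i j; rewrite mxE; apply: (smooth2_dert x t (sf i j)). Qed.

Lemma dxm_dtm f : smooth2_mx f -> dxm (dtm f) = dtm (dxm f).
Proof.
move=> sf; apply: functional_extensionality => x; apply: functional_extensionality => t.
apply/matrixP => i j; rewrite !mxE.
transitivity (Dx (Dt (fun x t => f x t i j)) x t).
  by apply: Derive_ext => y; rewrite mxE.
by rewrite smooth2_Schwarz //; apply: Derive_ext => s; rewrite mxE.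
Qed.

Lemma smooth2_mx_slice f t : smooth2_mx f -> smooth_mx (fun x => f x t).
Proof. by move=> sf i j; apply: (smooth2_slice t (sf i j)). Qed.

Lemma smooth_mx_lift (f : R -> 'M[R]_(m, n)) :
  smooth_mx f -> smooth2_mx (fun x _ => f x).
Proof. by move=> sf i j; apply: (smooth2_lift (sf i j)). Qed.

Lemma smooth2_mx_comp (f : R -> 'M[R]_(m, n)) p :
  smooth_mx f -> smooth2 p -> smooth2_mx (fun x t => f (p x t)).
Proof. by move=> sf sp i j; apply: (smooth2_comp (sf i j) sp). Qed.

End Smooth2Mx.

Lemma smooth2_inner u v : smooth2_mx u -> smooth2_mx v ->
  smooth2 (fun x t => inner (u x t) (v x t)).
Proof.
move=> su sv.
rewrite (_ : (fun x t => _) = fun x t => u x t 0 0 * v x t 0 0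
    + 2^-1 * (u x t 1 0 * v x t 2 0 + u x t 2 0 * v x t 1 0)).
  apply: smooth2D; first by apply: smooth2M; [apply: su | apply: sv].
  apply: smooth2M; first exact: smooth2_cst.
  by apply: smooth2D; apply: smooth2M; try apply: su; apply: sv.
by do 2!apply: functional_extensionality => ?; rewrite innerE.
Qed.

Lemma smooth2_col n (g : R -> R -> 'M[R]_(3, n)) j :
  smooth2_mx g -> smooth2_mx (fun x t => col j (g x t)).
Proof.
move=> sg; apply: (smooth2_mxE (F := fun i _ x t => g x t i j)).
  by move=> *; rewrite mxE.
by [].
Qed.

Lemma smooth2_cols e0 e1 e2 : smooth2_mx e0 -> smooth2_mx e1 -> smooth2_mx e2 ->
  smooth2_mx (fun x t => cols (e0 x t) (e1 x t) (e2 x t)).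
Proof.
move=> s0 s1 s2.
apply: (smooth2_mxE (F := fun i j x t => (nth 0 [:: e0 x t; e1 x t; e2 x t] j) i 0)).
  by move=> *; rewrite mxE.
by move=> i j; move: j i; apply: ord3_ind => i /=; [apply: s0|apply: s1|apply: s2].
Qed.

Lemma smooth_is_derive f x : smooth f -> is_derive f x (Derive f x).
Proof. by move=> sf; apply/Derive_correct/smooth_ex_derive. Qed.

(** * The flow velocity of one curve, in a null p-frame *)

Section Slice.
Variables (c : R -> 'cV[R]_3) (g : R -> 'M[R]_3) (k1 k2 : R -> R).
Hypothesis fr : null_p_frame c g k1 k2.

Let e0 x := col 0 (g x).
Let e1 x := col 1 (g x).
Let e2 x := col 2 (g x).

Lemma frame_triple x : null_triple (e0 x) (e1 x) (e2 x).
Proof. by have /null_p_frameP[_ nt _ _] := fr; exact: nt. Qed.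

Lemma frame_comb_derive (a b d : R -> R) (x a' b' d' : R) :
  is_derive a x a' -> is_derive b x b' -> is_derive d x d' ->
  is_dmx (fun y => a y *: e0 y + b y *: e1 y + d y *: e2 y) x
    ((a' - 2^-1 * (b x * k2 x + d x * k1 x)) *: e0 x
     + (b' + a x * k1 x) *: e1 x + (d' + a x * k2 x) *: e2 x).
Proof.
have /null_p_frameP[_ _ _ /(_ x)[d0 d1 d2]] := fr.
move=> ax bx dx; apply: is_dmx_eq.
  by apply: is_dmxD; [apply: is_dmxD|]; apply: is_dmxZ; eassumption.
by apply/matrixP => i j; rewrite !mxE; field.
Qed.

Lemma frame_curvature1 x : k1 x = 2 * inner (Dmx e0 x) (e2 x).
Proof.
have /null_p_frameP[_ _ _ /(_ x)[d0 _ _]] := fr; have nt := frame_triple x.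
by rewrite (is_dmx_unique d0) !innerL (nt12 nt) (nt22 nt); field.
Qed.

Lemma frame_curvature2 x : k2 x = 2 * inner (Dmx e0 x) (e1 x).
Proof.
have /null_p_frameP[_ _ _ /(_ x)[d0 _ _]] := fr; have nt := frame_triple x.
by rewrite (is_dmx_unique d0) !innerL (nt11 nt) (nt21 nt); field.
Qed.

Lemma frame_curvature_smooth : smooth k1 /\ smooth k2.
Proof.
have [sg _ _ _] := fr; have sg2 := smooth_mx_lift sg.
have scol j := smooth2_col j sg2.
split.
  apply: smooth_of2; rewrite (_ : (fun x _ => k1 x) = fun x t =>
      2 * inner (dxm (fun x _ => e0 x) x t) (e2 x)).
    apply: smooth2M; first exact: smooth2_cst.
    by apply: (smooth2_inner (smooth2_dxm (scol 0)) (scol 2)).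
  by do 2!apply: functional_extensionality => ?; apply: frame_curvature1.
apply: smooth_of2; rewrite (_ : (fun x _ => k2 x) = fun x t =>
    2 * inner (dxm (fun x _ => e0 x) x t) (e1 x)).
  apply: smooth2M; first exact: smooth2_cst.
  by apply: (smooth2_inner (smooth2_dxm (scol 0)) (scol 1)).
by do 2!apply: functional_extensionality => ?; apply: frame_curvature2.
Qed.

Lemma frame_mean_curvature x : mean_curvature c x = k1 x *: e1 x + k2 x *: e2 x.
Proof.
have /null_p_frameP[_ _ tg /(_ x)[d0 _ _]] := fr.
rewrite /mean_curvature (functional_extensionality _ _ tg).
exact: is_dmx_unique.
Qed.

Lemma frame_inner_H x : inner (mean_curvature c x) (mean_curvature c x) = k1 x * k2 x.
Proof.
have nt := frame_triple x.
by rewrite frame_mean_curvature !innerL (nt11 nt) (nt12 nt) (nt21 nt) (nt22 nt); field.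
Qed.

(** In the frame [H_x = - k1 k2 e0 + k1' e1 + k2' e2], and the normal projection removes the [e0]
    part. *)
Lemma frame_airy_velocity x : airy_velocity c x =
  (8^-1 * (k1 x * k2 x)) *: e0 x + (4^-1 * Derive k1 x) *: e1 x
  + (4^-1 * Derive k2 x) *: e2 x.
Proof.
have /null_p_frameP[_ _ tg _] := fr; have nt := frame_triple x.
have [sk1 sk2] := frame_curvature_smooth.
rewrite /airy_velocity /normal_derivative_H frame_inner_H tg -/(e0 x).
have -> : mean_curvature c = fun y => 0%R *: e0 y + k1 y *: e1 y + k2 y *: e2 y.
  apply: functional_extensionality => y.
  by rewrite frame_mean_curvature scale0r add0r.
rewrite (is_dmx_unique (frame_comb_derive (is_derive_cst 0%R x)
  (Derive_correct _ _ (smooth_ex_derive x sk1))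
  (Derive_correct _ _ (smooth_ex_derive x sk2)))).
rewrite !innerL (nt00 nt) (nt10 nt) (nt20 nt).
by apply/matrixP => i j; rewrite !mxE; field.
Qed.

Let C1 y := 8^-1 * (k1 y * k2 y) * k1 y + 4^-1 * Derive (Derive k1) y.
Let C2 y := 8^-1 * (k1 y * k2 y) * k2 y + 4^-1 * Derive (Derive k2) y.

(** There is no [e0] component: the derivative of [k1 k2 / 8] cancels what [k1' e1 / 4] and
    [k2' e2 / 4] contribute. The coefficient 1/8 of the flow is thus exactly what preserves unit
    speed to first order. *)
Lemma frame_airy_velocity_derive x :
  is_dmx (airy_velocity c) x (C1 x *: e1 x + C2 x *: e2 x).
Proof.
have [sk1 sk2] := frame_curvature_smooth.
apply: (is_dmx_ext (f := fun y => (8^-1 * (k1 y * k2 y)) *: e0 y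
    + (4^-1 * Derive k1 y) *: e1 y + (4^-1 * Derive k2 y) *: e2 y)).
  by move=> y; rewrite frame_airy_velocity.
apply: is_dmx_eq; first apply: frame_comb_derive.
- apply: is_deriveM; first exact: is_derive_cst.
  by apply: is_deriveM; apply: smooth_is_derive.
- apply: is_deriveM; first exact: is_derive_cst.
  exact: (smooth_is_derive x (smooth_Derive sk1)).
- apply: is_deriveM; first exact: is_derive_cst.
  exact: (smooth_is_derive x (smooth_Derive sk2)).
by rewrite /C1 /C2; apply/matrixP => i j; rewrite !mxE; field.
Qed.

(** Along the flow this is both [(e0)_tx] and [H_t]: the first serves the curvature evolution, the
    second the KdV computation. *)
Lemma frame_airy_velocity_derive2 x :
  is_dmx (Dmx (airy_velocity c)) x
    (- (2^-1 * (C1 x * k2 x + C2 x * k1 x)) *: e0 x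
     + Derive C1 x *: e1 x + Derive C2 x *: e2 x).
Proof.
have [sk1 sk2] := frame_curvature_smooth.
have sC (k : R -> R) : smooth k ->
    smooth (fun y => 8^-1 * (k1 y * k2 y) * k y + 4^-1 * Derive (Derive k) y).
  move=> sk; apply: smooth_of2; apply: smooth2D.
    apply: smooth2M (smooth2_lift sk); apply: smooth2M; first exact: smooth2_cst.
    exact: smooth2M (smooth2_lift sk1) (smooth2_lift sk2).
  apply: smooth2M; first exact: smooth2_cst.
  exact: (smooth2_lift (smooth_Derive (smooth_Derive sk))).
apply: (is_dmx_ext (f := fun y => 0%R *: e0 y + C1 y *: e1 y + C2 y *: e2 y)).
  by move=> y; rewrite scale0r add0r (is_dmx_unique (frame_airy_velocity_derive y)).
apply: is_dmx_eq; first apply: frame_comb_derive.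
- exact: is_derive_cst.
- exact: (smooth_is_derive x (sC _ sk1)).
- exact: (smooth_is_derive x (sC _ sk2)).
by apply/matrixP => i j; rewrite !mxE; field.
Qed.

End Slice.

Lemma null_p_frame_cols c e0 e1 e2 k1 k2 :
  smooth_mx e0 -> smooth_mx e1 -> smooth_mx e2 ->
  (forall x, null_triple (e0 x) (e1 x) (e2 x)) ->
  (forall x, Dmx c x = e0 x) ->
  (forall x, is_dmx e0 x (k1 x *: e1 x + k2 x *: e2 x)) ->
  (forall x, is_dmx e1 x (- (k2 x / 2) *: e0 x)) ->
  (forall x, is_dmx e2 x (- (k1 x / 2) *: e0 x)) ->
  null_p_frame c (fun x => cols (e0 x) (e1 x) (e2 x)) k1 k2.
Proof.
move=> s0 s1 s2 nt tg d0 d1 d2; apply/null_p_frameP.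
have E0 : (fun y => col 0 (cols (e0 y) (e1 y) (e2 y))) = e0.
  by apply: functional_extensionality => y; rewrite col0_cols.
have E1 : (fun y => col 1 (cols (e0 y) (e1 y) (e2 y))) = e1.
  by apply: functional_extensionality => y; rewrite col1_cols.
have E2 : (fun y => col 2 (cols (e0 y) (e1 y) (e2 y))) = e2.
  by apply: functional_extensionality => y; rewrite col2_cols.
split=> [|x|x|x]; rewrite ?E0 ?E1 ?E2 ?col0_cols ?col1_cols ?col2_cols //.
apply: (smooth2_mx_slice 0 (f := fun x _ => cols (e0 x) (e1 x) (e2 x))).
by apply: smooth2_cols; apply: smooth_mx_lift.
Qed.

Lemma smooth_mx_col (g : R -> 'M[R]_3) j : smooth_mx g -> smooth_mx (fun x => col j (g x)).
Proof. by move=> /smooth_mx_lift/(smooth2_col j)/(smooth2_mx_slice 0). Qed.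

Lemma null_p_frame_swap c g k1 k2 : null_p_frame c g k1 k2 ->
  null_p_frame c (fun x => cols (col 0 (g x)) (col 2 (g x)) (col 1 (g x))) k2 k1.
Proof.
move=> /null_p_frameP[sg nt tg dg]; apply: null_p_frame_cols => // [||| |x|x|x].
- exact: smooth_mx_col.
- exact: smooth_mx_col.
- exact: smooth_mx_col.
- move=> x; have {}nt := nt x; split.
  + exact: nt00 nt.
  + exact: nt02 nt.
  + exact: nt01 nt.
  + exact: nt22 nt.
  + exact: nt21 nt.
  + exact: nt11 nt.
- by rewrite addrC; have [] := dg x.
- by have [] := dg x.
- by have [] := dg x.
Qed.

Lemma null_p_frame_boost c g k1 k2 r : r != 0 -> null_p_frame c g k1 k2 ->
  null_p_frame c (fun x => cols (col 0 (g x)) (r *: col 1 (g x)) (r^-1 *: col 2 (g x)))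
    (fun x => r^-1 * k1 x) (fun x => r * k2 x).
Proof.
move=> r0 /null_p_frameP[sg nt tg dg]; have sgc j := smooth_mx_col j sg.
have sZ (s : R) j : smooth_mx (fun x => s *: col j (g x)).
  apply: (smooth2_mx_slice 0 (f := fun x _ => s *: col j (g x))).
  by apply: (smooth2_mxZ (smooth2_cst s)); apply: smooth_mx_lift.
have dZ (s x : R) u du : is_dmx u x du -> is_dmx (fun y => s *: u y) x (s *: du : 'cV[R]_3).
  move=> ux; apply: is_dmx_eq; first exact: is_dmxZ (is_derive_cst s x) ux.
  by rewrite scale0r add0r.
apply: null_p_frame_cols => // [x|x|x|x].
- have {}nt := nt x; split; rewrite ?innerL ?(nt00 nt) ?(nt01 nt) ?(nt02 nt)
    ?(nt11 nt) ?(nt12 nt) ?(nt22 nt) ?mulr0 //.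
  by rewrite mulrA mulfV ?mul1r.
- have [+ _ _] := dg x; congr is_dmx; rewrite !scalerA.
  by rewrite [_ * k1 x * _]mulrAC [_ * k2 x * _]mulrAC mulVf // mulfV // !mul1r.
- have [_ + _] := dg x => /(dZ r); congr is_dmx; rewrite scalerA.
  by congr (_ *: _); field.
- have [_ _ +] := dg x => /(dZ r^-1); congr is_dmx; rewrite scalerA.
  by congr (_ *: _); field.
Qed.

(** * The flow in a moving frame *)

Lemma derive0_cst (f : R -> R) : (forall x, is_derive f x 0%R) -> forall x y, f x = f y.
Proof.
move=> f0 x y.
have [||c [_]] := MVT_gen f x y (fun=> 0%R); first by move=> ? _; apply: f0.
  move=> z _; apply: derivable_continuous_pt; apply: ex_derive_Reals_0.
  by eexists; apply: f0.
by rewrite Rmult_0_l => h; symmetry; apply: Rminus_diag_uniq.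
Qed.

Section Flow.
Variables (gam : R -> R -> 'cV[R]_3) (g : R -> R -> 'M[R]_3) (k1 k2 : R -> R -> R).
Hypotheses (sol : airy_solution gam) (sg : smooth2_mx g).
Hypothesis fr : forall t, null_p_frame (fun x => gam x t) (fun x => g x t)
  (fun x => k1 x t) (fun x => k2 x t).

Let E (j : 'I_3) x t := col j (g x t).

Let sE j : smooth2_mx (E j).
Proof. exact: smooth2_col. Qed.

Let nt x t : null_triple (E 0 x t) (E 1 x t) (E 2 x t).
Proof. exact: frame_triple (fr t) x. Qed.

Lemma flow_curvature_smooth : smooth2 k1 /\ smooth2 k2.
Proof.
split.
  rewrite (_ : k1 = fun x t => 2 * inner (dxm (E 0) x t) (E 2 x t)).
    apply: smooth2M; first exact: smooth2_cst.
    exact: smooth2_inner (smooth2_dxm (sE 0)) (sE 2).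
  apply: functional_extensionality => x; apply: functional_extensionality => t.
  exact: frame_curvature1 (fr t) x.
rewrite (_ : k2 = fun x t => 2 * inner (dxm (E 0) x t) (E 1 x t)).
  apply: smooth2M; first exact: smooth2_cst.
  exact: smooth2_inner (smooth2_dxm (sE 0)) (sE 1).
apply: functional_extensionality => x; apply: functional_extensionality => t.
exact: frame_curvature2 (fr t) x.
Qed.

Let C1 x t := 8^-1 * (k1 x t * k2 x t) * k1 x t + 4^-1 * Dx (Dx k1) x t.
Let C2 x t := 8^-1 * (k1 x t * k2 x t) * k2 x t + 4^-1 * Dx (Dx k2) x t.
(** The [e1] component of [(e1)_t], that is, the rate at which the null normal pair is boosted in
    time. *)
Let alpha x t := 2 * inner (dtm (E 1) x t) (E 2 x t).

Let sgam : smooth2_mx gam. Proof. by case: sol. Qed.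

Let dtm_gam x t : dtm gam x t = airy_velocity (fun y => gam y t) x.
Proof. by case: sol => _ _; apply. Qed.

Let E0E : E 0 = dxm gam.
Proof.
apply: functional_extensionality => x; apply: functional_extensionality => t.
by have /null_p_frameP[_ _ + _] := fr t => /(_ x).
Qed.

Let dtE0 x t : dtm (E 0) x t = C1 x t *: E 1 x t + C2 x t *: E 2 x t.
Proof.
rewrite E0E -dxm_dtm //; have := is_dmx_unique (frame_airy_velocity_derive (fr t) x).
by rewrite -/(C1 x t) => <-; congr Dmx; apply: functional_extensionality => y; rewrite dtm_gam.
Qed.

Let dxdtE0 x t : dxm (dtm (E 0)) x t =
  - (2^-1 * (C1 x t * k2 x t + C2 x t * k1 x t)) *: E 0 x t
  + Dx C1 x t *: E 1 x t + Dx C2 x t *: E 2 x t.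
Proof.
have := is_dmx_unique (frame_airy_velocity_derive2 (fr t) x) => <-.
rewrite E0E -dxm_dtm //; congr Dmx; apply: functional_extensionality => y.
by rewrite /dxm; congr Dmx; apply: functional_extensionality => z; rewrite dtm_gam.
Qed.

Let dxE x t : [/\ dxm (E 0) x t = k1 x t *: E 1 x t + k2 x t *: E 2 x t,
  dxm (E 1) x t = - (k2 x t / 2) *: E 0 x t &
  dxm (E 2) x t = - (k1 x t / 2) *: E 0 x t].
Proof.
have /null_p_frameP[_ _ _ /(_ x)[d0 d1 d2]] := fr t.
by split; apply: is_dmx_unique.
Qed.

Let dtE x t j : is_dmx (E j x) t (dtm (E j) x t).
Proof. exact: smooth2_is_dmxt. Qed.

Let dt_inner x t i j a : (forall t, inner (E i x t) (E j x t) = a) ->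
  inner (dtm (E i) x t) (E j x t) = - inner (E i x t) (dtm (E j) x t).
Proof.
move=> h; have d := is_derive_inner (dtE x t i) (dtE x t j).
have : is_derive (fun y : R => inner (E i x y) (E j x y)) t 0%R.
  by apply: is_derive_ext (is_derive_cst a t) => s; rewrite h.
move=> /is_derive_unique; rewrite (is_derive_unique _ _ _ d) => {}d.
by lra.
Qed.

(** Equality of mixed derivatives of [e0], paired with [e2] and with [e1]. Differentiating the Gram
    relations in time shows that [(e1)_t] and [(e2)_t] contribute opposite multiples of [alpha]. *)
Let dtk x t : Dt k1 x t = Dx C1 x t - k1 x t * alpha x t /\
  Dt k2 x t = Dx C2 x t + k2 x t * alpha x t.
Proof.
have [sk1 sk2] := flow_curvature_smooth.
have d : is_dmx (dxm (E 0) x) t (Dt k1 x t *: E 1 x t + k1 x t *: dtm (E 1) x t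
    + (Dt k2 x t *: E 2 x t + k2 x t *: dtm (E 2) x t)).
  apply: (is_dmx_ext (f := fun t => k1 x t *: E 1 x t + k2 x t *: E 2 x t)).
    by move=> s; have [-> _ _] := dxE x s.
  by apply: is_dmxD; apply: is_dmxZ => //; apply: smooth2_dert.
have := is_dmx_unique d; rewrite -[Dmx _ _]/(dtm (dxm (E 0)) x t) -dxm_dtm // dxdtE0.
have n := nt x t.
have h11 : inner (dtm (E 1) x t) (E 1 x t) = 0.
  have := dt_inner t (fun t => nt11 (nt x t)); rewrite innerC; lra.
have h22 : inner (dtm (E 2) x t) (E 2 x t) = 0.
  have := dt_inner t (fun t => nt22 (nt x t)); rewrite innerC; lra.
have h21 : inner (dtm (E 2) x t) (E 1 x t) = - 2^-1 * alpha x t.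
  by rewrite /alpha (dt_inner t (fun t => nt12 (nt x t))) innerC; field.
have h12 : inner (dtm (E 1) x t) (E 2 x t) = 2^-1 * alpha x t.
  by rewrite /alpha; field.
move=> h; have h1 := f_equal (inner^~ (E 1 x t)) h.
have h2 := f_equal (inner^~ (E 2 x t)) h.
move: h1 h2; rewrite !innerL (nt01 n) (nt02 n) (nt11 n) (nt12 n) (nt21 n) (nt22 n).
rewrite h11 h22 h21 h12 => h1 h2.
by split; lra.
Qed.

(** Equality of mixed derivatives of [e1]. The right-hand side is exact: it is the [x]-derivative of
    [(k1 k2' - k2 k1') / 8]. *)
Let dx_alpha x t : Dx alpha x t =
  8^-1 * (k1 x t * Dx (Dx k2) x t - k2 x t * Dx (Dx k1) x t).
Proof.
have [sk1 sk2] := flow_curvature_smooth.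
have d1 := smooth2_is_dmx x t (smooth2_dtm (sE 1)).
have d2 := smooth2_is_dmx x t (sE 2).
have d := is_deriveM (is_derive_cst 2%R x) (is_derive_inner d1 d2).
rewrite /Dx (is_derive_unique _ _ _ d); have [_ _ ->] := dxE x t.
have d3 : is_dmx (dxm (E 1) x) t (- (Dt k2 x t / 2) *: E 0 x t
    + - (k2 x t / 2) *: dtm (E 0) x t).
  apply: (is_dmx_ext (f := fun t => - (k2 x t / 2) *: E 0 x t)).
    by move=> s; have [_ -> _] := dxE x s.
  apply: is_dmxZ => //; apply: is_deriveN.
  apply: is_derive_eq.
    apply: is_deriveM; first exact: smooth2_dert.
    exact: is_derive_cst.
  by rewrite mulr0 addr0.
have -> : dxm (dtm (E 1)) x t = - (Dt k2 x t / 2) *: E 0 x t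
    + - (k2 x t / 2) *: dtm (E 0) x t.
  by rewrite dxm_dtm //; exact: is_dmx_unique d3.
have h10 := dt_inner t (fun t => nt10 (nt x t)).
have n := nt x t; rewrite !innerL h10 dtE0 !innerL.
by rewrite (nt02 n) (nt11 n) (nt12 n) (nt22 n) /C1 /C2 /Dx; field.
Qed.

(* The time-dependent gauge [c] is the remaining freedom of boosting the null
   normal frame by a function of [t]. *)
Lemma curvature_evolution : exists c : R -> R, smooth c /\ forall x t,
  Dt k1 x t = 4^-1 * Dx (Dx (Dx k1)) x t
    + 3 / 8 * (k1 x t * k2 x t) * Dx k1 x t - c t * k1 x t /\
  Dt k2 x t = 4^-1 * Dx (Dx (Dx k2)) x t
    + 3 / 8 * (k1 x t * k2 x t) * Dx k2 x t + c t * k2 x t.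
Proof.
have [sk1 sk2] := flow_curvature_smooth.
(* [beta] is independent of [x], hence the gauge function. Substituting for [alpha] cancels
   [k1 ^ 2 k2'] in the first equation and [k2 ^ 2 k1'] in the second, which leaves the coefficient
   3/8. *)
pose beta x t := alpha x t - 8^-1 * (k1 x t * Dx k2 x t - k2 x t * Dx k1 x t).
have salpha : smooth2 alpha.
  apply: smooth2M; first exact: smooth2_cst.
  exact: smooth2_inner (smooth2_dtm (sE 1)) (sE 2).
have sbeta : smooth2 beta.
  apply: smooth2D => //; apply: smooth2N; apply: smooth2M; first exact: smooth2_cst.
  apply: smooth2D; first exact: smooth2M (smooth2_Dx sk2).
  exact: smooth2N (smooth2M sk2 (smooth2_Dx sk1)).
have d1 x t := smooth2_derx x t sk1.
have d2 x t := smooth2_derx x t sk2.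
have d11 x t := smooth2_derx x t (smooth2_Dx sk1).
have d21 x t := smooth2_derx x t (smooth2_Dx sk2).
have d12 x t := smooth2_derx x t (smooth2_Dx (smooth2_Dx sk1)).
have d22 x t := smooth2_derx x t (smooth2_Dx (smooth2_Dx sk2)).
have betaE x t : beta x t = beta 0 t.
  apply: (derive0_cst (f := beta^~ t)) => {}x; apply: is_derive_eq.
    apply: is_deriveB; first exact: smooth2_derx salpha.
    apply: is_deriveM; first exact: is_derive_cst.
    by apply: is_deriveB; apply: is_deriveM.
  by rewrite dx_alpha; ring.
exists (beta 0); split; first exact: smooth2_slicet.
have dC x t (k : R -> R -> R) : smooth2 k ->
    Dx (fun x t => 8^-1 * (k1 x t * k2 x t) * k x t + 4^-1 * Dx (Dx k) x t) x t =
    8^-1 * ((Dx k1 x t * k2 x t + k1 x t * Dx k2 x t) * k x t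
      + k1 x t * k2 x t * Dx k x t) + 4^-1 * Dx (Dx (Dx k)) x t.
  move=> sk; apply: is_derive_unique; apply: is_derive_eq.
    apply: is_deriveD; apply: is_deriveM.
    - apply: is_deriveM; first exact: is_derive_cst.
      by apply: is_deriveM.
    - exact: smooth2_derx.
    - exact: is_derive_cst.
    - exact: (smooth2_derx x t (smooth2_Dx (smooth2_Dx sk))).
  by rewrite /=; ring.
move=> x t; have [-> ->] := dtk x t; rewrite -(betaE x t) !dC // /beta; by split; field.
Qed.

End Flow.

(** * Persistence of a constant principal curvature *)

Lemma smooth_locally_bounded f : smooth f ->
  forall T, exists C, forall t, Rle (Rabs t) T -> Rle (Rabs (f t)) C.
Proof.
move=> sf T; have [hT|/Rnot_le_lt hT] := Rle_dec (IZR 0) T; last first.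
  by exists (IZR 0) => t ht; have := Rabs_pos t; Lra.lra.
have cf t : continuity_pt f t.
  by apply: derivable_continuous_pt; apply: ex_derive_Reals_0; apply: smooth_ex_derive.
have [|M [hM _]] := continuity_ab_maj f (Ropp T) T _ (fun t _ => cf t); first by Lra.lra.
have [|m [hm _]] := continuity_ab_min f (Ropp T) T _ (fun t _ => cf t); first by Lra.lra.
exists (Rplus (Rabs (f M)) (Rabs (f m))) => t /Rabs_le_between ht.
have h1 := hM t ht; have h2 := hm t ht.
have [p1 p2] := (Rabs_pos (f M), Rabs_pos (f m)).
have q1 := Rle_abs (f M); have q2 := Rle_abs (Ropp (f m)).
by rewrite Rabs_Ropp in q2; apply: Rabs_le; Lra.lra.
Qed.

Definition bounded_curvature (k1 k2 : R -> R -> R) : Prop :=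
  forall T : R, exists C : R, forall (n : nat) (x t : R),
    (n <= 2)%nat -> `|t| <= T ->
    `|Derive_n (fun y => k1 y t) n x| <= C /\
    `|Derive_n (fun y => k2 y t) n x| <= C.

Lemma integrating_factor c t0 : smooth c -> exists E : R -> R,
  [/\ smooth E, E t0 = 1, forall t, E t != 0 &
      forall t, is_derive E t (c t * E t)].
Proof.
move=> sc; have sI := smooth2_RInt t0 (smooth2_lift sc).
have dI t := smooth2_RInt_derx t0 t 0 (smooth2_lift sc).
exists (fun t => exp (RInt c t0 t)); split.
- apply: smooth_of2; apply: (smooth2_comp smooth_exp); exact: smooth2_lift (smooth2_slice 0 sI).
- by rewrite RInt_point exp_0.
- by move=> t; apply/eqP; apply: Rgt_not_eq; apply: exp_pos.
- by move=> t; apply: is_derive_comp1 => //; apply: is_derive_exp.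
Qed.

(** Both [k2] and [a * E], with [E] the integrating factor of the gauge, solve the linear equation
    with coefficient [b = 3/8 k1 k2], and they agree at [t0]; uniqueness applies to their difference
    [w]. *)
Lemma constant_curvature_persists gam g k1 k2 t0 a :
  airy_solution gam -> smooth2_mx g ->
  (forall t, null_p_frame (fun x => gam x t) (fun x => g x t)
     (fun x => k1 x t) (fun x => k2 x t)) ->
  bounded_curvature k1 k2 -> (forall x, k2 x t0 = a) ->
  exists E : R -> R, (forall t, E t != 0) /\ forall x t, k2 x t = a * E t.
Proof.
move=> sol sg fr bdd k2t0.
have [sk1 sk2] := flow_curvature_smooth sg fr.
have [c [sc evol]] := curvature_evolution sol sg fr.
have [E [sE E0 E_neq0 dE]] := integrating_factor t0 sc.
exists E; split=> // x t; apply/eqP; rewrite -subr_eq0; apply/eqP.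
pose w x t := k2 x t - a * E t.
pose b x t := 3 / 8 * (k1 x t * k2 x t).
have sw : smooth2 w.
  apply: smooth2D => //; apply: smooth2N; apply: smooth2M; first exact: smooth2_cst.
  exact: smooth2_liftt.
have sb : smooth2 b by apply: smooth2M; [apply: smooth2_cst | apply: smooth2M].
have dxb y s : Dx b y s = 3 / 8 * (Dx k1 y s * k2 y s + k1 y s * Dx k2 y s).
  apply: is_derive_unique; apply: is_derive_eq.
    apply: is_deriveM; first exact: is_derive_cst.
    by apply: is_deriveM; apply: smooth2_derx.
  by rewrite mul0r add0r.
have dxw : Dx w = Dx k2.
  apply: functional_extensionality => y; apply: functional_extensionality => s.
  apply: is_derive_unique; apply: is_derive_eq.
    by apply: is_deriveB; [apply: smooth2_derx | apply: is_derive_cst].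
  by rewrite subr0.
apply: (third_order_uniqueness (w := w) (b := b) (c := c) (t0 := t0)) => //.
- move=> y s; rewrite dxw.
  have -> : Dt w y s = Dt k2 y s - a * (c s * E s).
    apply: is_derive_unique; apply: is_derive_eq.
      apply: is_deriveB; first exact: smooth2_dert.
      by apply: is_deriveM; [apply: is_derive_cst | apply: dE].
    by rewrite mul0r add0r.
  have [_ ->] := evol y s; rewrite /b /w !RealsE /=; ring.
- move=> T; have [C hC] := bdd T.
  have [B hB] := smooth_locally_bounded sc T.
  have [F hF] := smooth_locally_bounded sE T.
  (* The curvature bound does not state [0 <= C]; a negative [C] is only possible when no time
     satisfies the constraint. *)
  have [C0|C0] := boolP (0 <= C); last first.
    exists C => y s /RleP; rewrite RabsE => hs; have [h _] := hC 0%N y s isT hs.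
    by case/negP: C0; apply: le_trans h.
  (* One constant for all six bounds: [C + |a| |F|] for [w], [C] for its derivatives, [C ^+ 2] for
     [b] and [Dx b], [|B|] for the gauge. *)
  exists (C + `|a| * `|F| + `|B| + C ^+ 2) => y s hT.
  have hs : `|s| <= T by rewrite -RabsE; apply/RleP.
  have [a0 a0'] := hC 0%N y s isT hs; have [a1 a1'] := hC 1%N y s isT hs.
  have [_ a2'] := hC 2%N y s isT hs; rewrite /= in a0 a0' a1 a1' a2'.
  have hBs : `|c s| <= `|B|.
    by apply: (le_trans (y := B)); [rewrite -RabsE; apply/RleP/hB | apply: ler_norm].
  have hFs : `|E s| <= `|F|.
    by apply: (le_trans (y := F)); [rewrite -RabsE; apply/RleP/hF | apply: ler_norm].
  have n1 : 0 <= `|a| * `|F| by rewrite mulr_ge0.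
  have n2 : 0 <= `|B| by [].
  have n3 : 0 <= C ^+ 2 by rewrite exprn_ge0.
  have pr (u v : R) : `|u| <= C -> `|v| <= C -> `|u * v| <= C ^+ 2.
    by move=> hu hv; rewrite normrM expr2 ler_pM.
  have le34 (u : R) : `|u| <= 2 * C ^+ 2 -> `|3 / 8 * u| <= C ^+ 2.
    by rewrite normrM ger0_norm; lra.
  do 5?[split]; apply/RleP; rewrite RabsE ?dxw.
  + rewrite /w; apply: le_trans (ler_normB _ _) _; rewrite normrM.
    have : `|a| * `|E s| <= `|a| * `|F| by rewrite ler_wpM2l.
    lra.
  + by apply: le_trans a1' _; lra.
  + by apply: le_trans a2' _; lra.
  + have : `|b y s| <= C ^+ 2 by apply: le34; have := pr _ _ a0 a0'; lra.
    lra.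
  + rewrite dxb; set D := (X in `|3 / 8 * X|).
    have : `|3 / 8 * D| <= C ^+ 2.
      apply: le34; apply: le_trans (ler_normD _ _) _.
      by have := pr _ _ a1 a0'; have := pr _ _ a0 a1'; rewrite /Dx; lra.
    lra.
  + by apply: le_trans hBs _; lra.
- by move=> y; rewrite /w k2t0 E0 mulr1 subrr.
Qed.

Lemma has_constant_curvatureP c a :
  has_constant_curvature c a <-> exists g k1, null_p_frame c g k1 (fun=> a).
Proof.
split=> [[g [k1 [k2 [fr [k1a|k2a]]]]]|[g [k1 fr]]].
- have -> : (fun=> a) = k1 by apply: functional_extensionality => x; rewrite k1a.
  by do 2!eexists; apply: null_p_frame_swap fr.
- have -> : (fun=> a) = k2 by apply: functional_extensionality => x; rewrite k2a.
  by exists g, k1.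
- by exists g, k1, (fun=> a); split=> //; right.
Qed.

(* Null p-frames of a curve differ by a constant boost, up to interchanging the
   null fields. *)
Lemma constant_curvature_in_frame c g k1 k2 a : null_p_frame c g k1 k2 ->
  has_constant_curvature c a -> exists r : R, r != 0 /\
    ((forall x, k1 x = r * a) \/ (forall x, k2 x = r * a)).
Proof.
move=> fr /has_constant_curvatureP[g' [k1' fr']].
have /null_p_frameP[_ nt tg dg] := fr; have /null_p_frameP[_ nt' tg' dg'] := fr'.
have e0E x : col 0 (g' x) = col 0 (g x) by rewrite -tg -tg'.
(* Null fields of both frames have derivatives along the common tangent [e0], to which they are all
   orthogonal; their mutual products are therefore constant. *)
have cstp j : j = 1 \/ j = 2 ->
    exists p, forall x, inner (col 1 (g' x)) (col j (g x)) = p.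
  move=> hj; exists (inner (col 1 (g' 0)) (col j (g 0))) => x.
  apply: (derive0_cst (f := fun x => inner (col 1 (g' x)) (col j (g x)))) => {}x.
  have [_ d1' _] := dg' x; have [_ d1 d2] := dg x.
  have n := nt x; have n' := nt' x.
  case: hj => ->; (apply: is_derive_eq; first by apply: is_derive_inner; eassumption).
    by rewrite !innerL e0E (nt01 n) -e0E (nt10 n') !mulr0 addr0.
  by rewrite !innerL e0E (nt02 n) -e0E (nt10 n') !mulr0 addr0.
have [p2 hp2] := cstp 2 (or_intror erefl); have [p1 hp1] := cstp 1 (or_introl erefl).
have e1E x : col 1 (g' x) = (2 * p2) *: col 1 (g x) + (2 * p1) *: col 2 (g x).
  rewrite (null_triple_decomp (col 1 (g' x)) (nt x)) hp1 hp2 -e0E (nt10 (nt' x)).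
  by rewrite scale0r add0r.
have aE x : a = 2 * (k1 x * p1 + k2 x * p2).
  have [d0 _ _] := dg x; have [d0' _ _] := dg' x; have n := nt x; have n' := nt' x.
  have /(f_equal (inner^~ (col 1 (g' x)))) : k1' x *: col 1 (g' x) + a *: col 2 (g' x) =
      k1 x *: col 1 (g x) + k2 x *: col 2 (g x).
    apply: is_dmx_uniq d0' _; apply: is_dmx_ext d0 => y; by rewrite e0E.
  rewrite [X in X = _]innerL !innerL (nt11 n') (nt21 n') !(innerC _ (col 1 (g' x))).
  rewrite hp1 hp2; lra.
(* This is nullity of the first null field of [g']. One of its two coefficients vanishes, so it is a
   multiple of [e1] or of [e2], which gives the two alternatives of the conclusion. *)
have pp : p1 * p2 = 0.
  have n := nt 0; have := nt11 (nt' 0).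
  rewrite e1E !innerL (nt11 n) (nt12 n) (nt21 n) (nt22 n); lra.
have [p10|p1_neq0] := eqVneq p1 0.
  have p2_neq0 : p2 != 0.
    apply/eqP => p20; have := nt12 (nt' 0).
    rewrite e1E p10 p20 !mulr0 !scale0r add0r -(scale0r 0) innerZl mul0r; lra.
  exists (2 * p2)^-1; split; first by rewrite invr_eq0 mulf_neq0 // pnatr_eq0.
  by right=> x; rewrite (aE x) p10; field.
have p20 : p2 = 0 by apply/eqP; move/eqP: pp; rewrite mulf_eq0 (negbTE p1_neq0).
exists (2 * p1)^-1; split; first by rewrite invr_eq0 mulf_neq0 // pnatr_eq0.
by left=> x; rewrite (aE x) p20; field.
Qed.

Lemma bounded_curvature_swap k1 k2 : bounded_curvature k1 k2 -> bounded_curvature k2 k1.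
Proof.
move=> b T; have [C hC] := b T; exists C => n x t hn ht.
by have [] := hC n x t hn ht.
Qed.

(** Besides invariance, this provides a frame smooth in [(x, t)] whose second curvature depends on
    time alone, ready to be boosted to the value 2. *)
Lemma airy_frame_constant_curvature gam t0 a :
  airy_solution gam -> locally_bounded_curvature gam ->
  has_constant_curvature (fun x => gam x t0) a ->
  exists g k1 (E : R -> R), [/\ smooth2_mx g, forall t, E t != 0 &
    forall t, null_p_frame (fun x => gam x t) (fun x => g x t) (fun x => k1 x t)
      (fun=> a * E t)].
Proof.
move=> sol [g [k1 [k2 [sg fr bdd]]]] ka.
have {ka}[r [r0 hr]] := constant_curvature_in_frame (fr t0) ka.
have concl g' k1' k2' : smooth2_mx g' ->
    (forall t, null_p_frame (fun x => gam x t) (fun x => g' x t)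
                 (fun x => k1' x t) (fun x => k2' x t)) ->
    bounded_curvature k1' k2' -> (forall x, k2' x t0 = r * a) ->
    exists g k1 (E : R -> R), [/\ smooth2_mx g, forall t, E t != 0 &
      forall t, null_p_frame (fun x => gam x t) (fun x => g x t) (fun x => k1 x t)
        (fun=> a * E t)].
  move=> sg' fr' bdd' h; have [E [E0 hE]] := constant_curvature_persists sol sg' fr' bdd' h.
  exists g', k1', (fun t => r * E t); split=> // [t|t]; first by rewrite mulf_neq0.
  have <- // : (fun x => k2' x t) = (fun=> a * (r * E t)).
  by apply: functional_extensionality => x; rewrite hE mulrA (mulrC a).
case: hr => hr; last exact: concl fr bdd hr.
apply: (concl (fun x t => cols (col 0 (g x t)) (col 2 (g x t)) (col 1 (g x t))) k2 k1) => //.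
- by apply: smooth2_cols; apply: smooth2_col.
- by move=> t; apply: null_p_frame_swap.
- exact: bounded_curvature_swap.
Qed.

(** The nonvanishing factor [r] lets the same statement serve [M0] and [M0_nonzero]. *)
Lemma airy_invariant_M0_flow gam t0 a : airy_solution gam ->
  locally_bounded_curvature gam -> has_constant_curvature (fun x => gam x t0) a ->
  forall t, exists r : R, r != 0 /\ has_constant_curvature (fun x => gam x t) (a * r).
Proof.
move=> sol lb ka t; have [g [k1 [E [_ E0 fr]]]] := airy_frame_constant_curvature sol lb ka.
by exists (E t); split=> //; apply/has_constant_curvatureP; do 2!eexists; apply: fr.
Qed.

(** * Normalization to [k_2 = 2] and the KdV equation *)

Lemma frame_mx_2 k : frame_mx k 2%R =
  k *: (delta_mx 1 0 - 2^-1 *: delta_mx 0 2) + 2 *: (delta_mx 2 0 - 2^-1 *: delta_mx 0 1).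
Proof.
apply/matrixP; apply: ord3_ind; apply: ord3_ind;
  by rewrite !mxE /= ?mulr1n ?mulr0n; field.
Qed.

Lemma Derive_cst (a : R) : Derive (fun=> a) = fun=> 0%R.
Proof. by apply: functional_extensionality => x; apply: Derive_const. Qed.

(** No column of [g] is differentiated in time, since frames at different times may be unrelated.
    Instead [(k1)_t = <H_t, H>], where [H_t] is the second [x]-derivative of the velocity, and the
    frame of one instant suffices to evaluate it. *)
Lemma airy_curvature_kdv gam g k1 : airy_solution gam ->
  (forall t, null_p_frame (fun x => gam x t) (fun x => g x t)
     (fun x => k1 x t) (fun=> 2)) ->
  KdV (fun x t => - 2^-1 * k1 x t).
Proof.
move=> sol fr; have [sgam _ flow] := sol.
pose H := dxm (dxm gam).
have sH : smooth2_mx H by do 2!apply: smooth2_dxm.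
have HE x t : H x t = mean_curvature (fun y => gam y t) x by [].
have k1E : k1 = fun x t => 2^-1 * inner (H x t) (H x t).
  apply: functional_extensionality => x; apply: functional_extensionality => t.
  by rewrite HE (frame_inner_H (fr t)); field.
have sk1 : smooth2 k1.
  rewrite k1E; apply: smooth2M; first exact: smooth2_cst.
  exact: smooth2_inner.
have sq : smooth2 (fun x t => - 2^-1 * k1 x t).
  by apply: smooth2M => //; apply: smooth2_cst.
have dtH x t : dtm H x t = Dmx (Dmx (airy_velocity (fun y => gam y t))) x.
  rewrite /H -!dxm_dtm //; last exact: smooth2_dxm.
  rewrite /dxm; congr Dmx; apply: functional_extensionality => y.
  by congr Dmx; apply: functional_extensionality => z; apply: flow.
have d1 x t := smooth2_derx x t sk1.
have d2 x t := smooth2_derx x t (smooth2_Dx sk1).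
have d3 x t := smooth2_derx x t (smooth2_Dx (smooth2_Dx sk1)).
have dtk1 x t : Dt k1 x t = 4^-1 * Dx (Dx (Dx k1)) x t + 3 / 4 * k1 x t * Dx k1 x t.
  have dH : is_dmx (H x) t (dtm H x t) by apply: smooth2_is_dmxt.
  rewrite {1}k1E /Dt (is_derive_unique _ _ _
    (is_deriveM (is_derive_cst (2^-1)%R t) (is_derive_inner dH dH))).
  rewrite dtH (is_dmx_unique (frame_airy_velocity_derive2 (fr t) x)).
  rewrite HE (frame_mean_curvature (fr t)).
  have n := frame_triple (fr t) x; rewrite !innerL.
  rewrite (nt01 n) (nt02 n) (nt10 n) (nt20 n) (nt11 n) (nt12 n) (nt21 n) (nt22 n).
  have -> : Derive (fun y => 8^-1 * (k1 y t * 2) * k1 y t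
      + 4^-1 * Derive (Derive (fun y => k1 y t)) y) x =
      2^-1 * k1 x t * Dx k1 x t + 4^-1 * Dx (Dx (Dx k1)) x t.
    apply: is_derive_unique; apply: is_derive_eq.
      apply: is_deriveD; apply: is_deriveM.
      - apply: is_deriveM; first exact: is_derive_cst.
        by apply: is_deriveM; [apply: d1 | apply: is_derive_cst].
      - exact: d1.
      - exact: is_derive_cst.
      - exact: d3.
    by rewrite /=; field.
  have -> : Derive (fun y => 8^-1 * (k1 y t * 2) * 2
      + 4^-1 * Derive (Derive (fun=> 2)) y) x = 2^-1 * Dx k1 x t.
    rewrite !Derive_cst; apply: is_derive_unique; apply: is_derive_eq.
      apply: is_deriveD; apply: is_deriveM.
      - apply: is_deriveM; first exact: is_derive_cst.
        by apply: is_deriveM; [apply: d1 | apply: is_derive_cst].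
      - exact: is_derive_cst.
      - exact: is_derive_cst.
      - exact: is_derive_cst.
    by rewrite /=; field.
  by field.
split=> // x t.
rewrite (Derive_n_Dx (fun x t => - 2^-1 * k1 x t)) /=.
have DxZ f : smooth2 f -> Dx (fun x t => - 2^-1 * f x t) = fun x t => - 2^-1 * Dx f x t.
  move=> sf; apply: functional_extensionality => y; apply: functional_extensionality => s.
  apply: is_derive_unique; apply: is_derive_eq.
    by apply: is_deriveM; [apply: is_derive_cst | apply: smooth2_derx].
  by rewrite mul0r add0r.
have -> : Derive (fun t => - 2^-1 * k1 x t) t = - 2^-1 * Dt k1 x t.
  apply: is_derive_unique; apply: is_derive_eq.
    by apply: is_deriveM; [apply: is_derive_cst | apply: smooth2_dert].
  by rewrite mul0r add0r.
rewrite -[Derive _ x]/(Dx (fun x t => - 2^-1 * k1 x t) x t).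
rewrite !DxZ //; [|exact: smooth2_Dx (smooth2_Dx sk1)|exact: smooth2_Dx].
by rewrite dtk1; field.
Qed.

Lemma normalized_frame c a : a != 0 -> has_constant_curvature c a ->
  exists g k1, null_p_frame c g k1 (fun=> 2).
Proof.
move=> a0 /has_constant_curvatureP[g [k1 fr]].
have r0 : 2 / a != 0 by rewrite mulf_neq0 ?invr_eq0 // pnatr_eq0.
have := null_p_frame_boost r0 fr.
by rewrite divfK // => fr'; do 2!eexists; exact: fr'.
Qed.

Lemma airy_normalized_frames gam : airy_solution gam ->
  (forall t, M0_nonzero (fun x => gam x t)) ->
  exists (g : R -> R -> 'M[R]_3) (k1 : R -> R -> R),
    (forall t, null_p_frame (fun x => gam x t) (fun x => g x t)
       (fun x => k1 x t) (fun=> 2)) /\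
    (locally_bounded_curvature gam -> smooth2_mx g).
Proof.
(* Under the bounds the smooth frame is boosted by [2 / (a * E t)]. Otherwise a frame is picked at
   each time by choice, and the smoothness clause is vacuous. *)
move=> sol M; have [lb|nlb] := Classical_Prop.classic (locally_bounded_curvature gam).
  have [_ _ [a [a0 ka]]] := M 0.
  have [g [k1 [E [sg E0 fr]]]] := airy_frame_constant_curvature sol lb ka.
  have aE0 t : a * E t != 0 by rewrite mulf_neq0 //; apply/eqP.
  (* Being a principal curvature of a frame smooth in [(x, t)], this function is smooth. *)
  have sE : smooth2 (fun _ t => a * E t).
    have [_ sk2] := flow_curvature_smooth sg fr.
    exact: sk2.
  have sr : smooth2 (fun _ t : R => 2 / (a * E t)).
    by apply: (smooth2M (smooth2_cst _)); apply: smooth2V.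
  have r0 t : 2 / (a * E t) != 0 by rewrite mulf_neq0 ?invr_eq0 // pnatr_eq0.
  exists (fun x t => cols (col 0 (g x t)) ((2 / (a * E t)) *: col 1 (g x t))
    ((2 / (a * E t))^-1 *: col 2 (g x t))), (fun x t => (2 / (a * E t))^-1 * k1 x t).
  split=> [t|_].
    have := null_p_frame_boost (r0 t) (fr t); by rewrite divfK.
  apply: smooth2_cols; first exact: smooth2_col.
    by apply: smooth2_mxZ => //; apply: smooth2_col.
  by apply: smooth2_mxZ; [apply: smooth2V | apply: smooth2_col].
have /functional_choice[G hG] : forall t, exists gk : (R -> 'M[R]_3) * (R -> R),
    null_p_frame (fun x => gam x t) gk.1 gk.2 (fun=> 2).
  move=> t; have [_ _ [a [/eqP a0 ka]]] := M t.
  by have [g [k1 fr]] := normalized_frame a0 ka; exists (g, k1).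
by exists (fun x t => (G t).1 x), (fun x t => (G t).2 x); split.
Qed.

(** * Tangency *)

Lemma frame_unit_speed c g k1 k2 : null_p_frame c g k1 k2 -> unit_speed c.
Proof.
move=> /null_p_frameP[_ nt tg _] x; rewrite tg; exact: nt00 (nt x).
Qed.

(** The new frame is the old one at [p x], changed by the null rotation fixing [e1] that sends [e0]
    to [e0 + m e1], followed by the boost dividing [e1] by [r = p']. The condition
    [2 r' = a m r ^ 2] says exactly that the rescaled [e1] is parallel in the new normal bundle with
    the same curvature constant [a]. *)
Lemma conformal_frame c g k1 (a : R) (p r m : R -> R) d :
  null_p_frame c g k1 (fun=> a) -> smooth p -> smooth r -> smooth m ->
  (forall x, is_derive p x (r x)) -> (forall x, r x != 0) ->
  (forall x, 2 * Derive r x = a * m x * r x ^+ 2) ->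
  (forall x, is_dmx d x (col 0 (g (p x)) + m x *: col 1 (g (p x)))) ->
  exists g' k1', null_p_frame d g' k1' (fun=> a).
Proof.
move=> /null_p_frameP[sg nt _ dg] sp sr sm dp r0 rE dd.
have dr x := smooth_is_derive x sr.
have dm x := smooth_is_derive x sm.
have r'E x : Derive r x = a * m x * r x ^+ 2 / 2 by rewrite -rE; field.
have de0 x : is_dmx (fun y => col 0 (g (p y))) x
    (r x *: (k1 (p x) *: col 1 (g (p x)) + a *: col 2 (g (p x)))).
  by apply: (is_dmx_comp (f := fun y => col 0 (g y))) => //; have [] := dg (p x).
have de1 x : is_dmx (fun y => col 1 (g (p y))) x
    (r x *: (- (a / 2) *: col 0 (g (p x)))).
  by apply: (is_dmx_comp (f := fun y => col 1 (g y))) => //; have [] := dg (p x).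
have de2 x : is_dmx (fun y => col 2 (g (p y))) x
    (r x *: (- (k1 (p x) / 2) *: col 0 (g (p x)))).
  by apply: (is_dmx_comp (f := fun y => col 2 (g y))) => //; have [] := dg (p x).
pose q0 x := col 0 (g (p x)) + m x *: col 1 (g (p x)).
pose q1 x := (r x)^-1 *: col 1 (g (p x)).
pose q2 x := r x *: col 2 (g (p x)) + (- 2^-1 * (r x * m x)) *: col 0 (g (p x))
  + (- 4^-1 * (r x * (m x * m x))) *: col 1 (g (p x)).
have se j : smooth2_mx (fun x (_ : R) => col j (g (p x))).
  apply: (@smooth2_mx_comp _ _ (fun x => col j (g x)) (fun x _ => p x)).
    exact: smooth_mx_col.
  exact: smooth2_lift.
have [sr2 sm2] := (smooth2_lift sr, smooth2_lift sm).
have srm2 := smooth2M sr2 sm2.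
exists (fun x => cols (q0 x) (q1 x) (q2 x)),
  (fun x => r x ^+ 2 * k1 (p x) + r x * Derive m x + a * (r x * m x) ^+ 2 / 4).
apply: null_p_frame_cols.
- apply: (smooth2_mx_slice 0 (f := fun x _ => q0 x)).
  by apply: smooth2_mxD => //; apply: smooth2_mxZ.
- apply: (smooth2_mx_slice 0 (f := fun x _ => q1 x)).
  by apply: smooth2_mxZ => //; apply: smooth2V.
- apply: (smooth2_mx_slice 0 (f := fun x _ => q2 x)).
  apply: smooth2_mxD.
    apply: smooth2_mxD; apply: smooth2_mxZ => //.
    exact: smooth2M (smooth2_cst _) srm2.
  apply: smooth2_mxZ => //; apply: (smooth2M (smooth2_cst _)).
  exact: smooth2M sr2 (smooth2M sm2 sm2).
- move=> x; have n := nt (p x); have rx := r0 x.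
  split; rewrite /q0 /q1 /q2 !innerL
    ?(nt00 n, nt01 n, nt02 n, nt10 n, nt11 n, nt12 n, nt20 n, nt21 n, nt22 n);
    by field.
- by move=> x; apply: is_dmx_unique.
- move=> x; have rx := r0 x; apply: is_dmx_eq.
    by apply: is_dmxD => //; apply: is_dmxZ.
  by rewrite /q1 /q2; apply/matrixP => i j; rewrite !mxE; field.
- move=> x; have rx := r0 x; apply: is_dmx_eq.
    by apply: is_dmxZ => //; apply: is_deriveV.
  by rewrite /q0 r'E; apply/matrixP => i j; rewrite !mxE; field.
- move=> x; have rx := r0 x; apply: is_dmx_eq.
    apply: is_dmxD; first apply: is_dmxD; apply: is_dmxZ => //.
      by apply: is_deriveM; [apply: is_derive_cst | apply: is_deriveM].
    apply: is_deriveM; first exact: is_derive_cst.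
    by apply: is_deriveM => //; apply: is_deriveM.
  by rewrite /q0 r'E; apply/matrixP => i j; rewrite !mxE; field.
Qed.

Lemma airy_tangent_null c g k1 : smooth_mx c -> null_p_frame c g k1 (fun=> 0) ->
  exists Gam : R -> R -> 'cV[R]_3, [/\ smooth2_mx Gam,
    forall s, exists g' k1', null_p_frame (fun x => Gam x s) g' k1' (fun=> 0),
    forall x, Gam x 0 = c x & forall x, Dmx (Gam x) 0 = airy_velocity c x].
Proof.
move=> sc fr; have /null_p_frameP[sg nt tg dg] := fr.
have [sk1 _] := frame_curvature_smooth fr; have sk1' := smooth_Derive sk1.
have dk1' x := smooth_is_derive x sk1'.
have dc x : is_dmx c x (col 0 (g x)) by rewrite -tg; apply: smooth_is_dmx.
have s4 : smooth2 (fun x s => 4^-1 * s * Derive k1 x).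
  apply: smooth2M (smooth2_lift sk1').
  exact: smooth2M (smooth2_cst _) smooth2_snd.
exists (fun x s => c x + (4^-1 * s * Derive k1 x) *: col 1 (g x)); split.
- apply: smooth2_mxD; first exact: smooth_mx_lift.
  apply: smooth2_mxZ => //; apply: smooth_mx_lift; exact: smooth_mx_col.
(* For [a = 0] the condition on [r] is met without reparametrizing; [m] is the [x]-derivative of the
   displacement along the constant field [e1]. *)
- move=> s; apply: (@conformal_frame c g k1 _ id (fun=> 1)
    (fun x => 4^-1 * s * Derive (Derive k1) x)) => //.
  + exact: smooth2_slice 0 smooth2_fst.
  + exact: smooth2_slice 0 (smooth2_cst _).
  + apply: smooth_of2; apply: (smooth2M (smooth2_cst _)).
    exact: smooth2_lift (smooth_Derive sk1').
  + by move=> x; apply: is_derive_id.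
  + by move=> x; apply: oner_neq0.
  + by move=> x; rewrite Derive_cst !mul0r mulr0.
  + move=> x; have [_ d1 _] := dg x; apply: is_dmx_eq.
      apply: is_dmxD; first exact: dc.
      apply: is_dmxZ; last exact: d1.
      by apply: is_deriveM => //; apply: is_derive_cst.
    by apply/matrixP => i j; rewrite !mxE; field.
- by move=> x; rewrite mulr0 mul0r scale0r addr0.
- move=> x; rewrite (frame_airy_velocity fr) Derive_cst; apply: is_dmx_unique.
  apply: is_dmx_eq.
    apply: is_dmxD; first exact: is_dmx_cst.
    apply: is_dmxZ; last exact: is_dmx_cst.
    apply: is_deriveM; last exact: is_derive_cst.
    apply: is_deriveM; first exact: is_derive_cst.
    exact: is_derive_idr.
  by apply/matrixP => i j; rewrite !mxE !R0E; field.
Qed.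

(* Here [c + (2 / a) e_1] is a point [p0], so [c - p0] lies on the light cone. If [u]
   takes values on the cone and has unit speed then so has [u (p x) / p' x]; these
   conformal reparametrizations produce the flow direction. *)
Lemma airy_tangent_cone c g k1 (a : R) : a != 0 -> smooth_mx c ->
  null_p_frame c g k1 (fun=> a) ->
  exists Gam : R -> R -> 'cV[R]_3, [/\ smooth2_mx Gam,
    forall s, exists g' k1', null_p_frame (fun x => Gam x s) g' k1' (fun=> a),
    forall x, Gam x 0 = c x & forall x, Dmx (Gam x) 0 = airy_velocity c x].
Proof.
move=> a0 sc fr; have /null_p_frameP[sg nt tg dg] := fr.
have [sk1 _] := frame_curvature_smooth fr; have sk1' := smooth_Derive sk1.
have dc x : is_dmx c x (col 0 (g x)) by rewrite -tg; apply: smooth_is_dmx.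
pose p0 := c 0 + (2 / a) *: col 1 (g 0).
have p0E x : c x = p0 - (2 / a) *: col 1 (g x).
  suff -> : p0 = c x + (2 / a) *: col 1 (g x) by rewrite addrK.
  apply/matrixP => i j.
  apply: (derive0_cst (f := fun x => (c x + (2 / a) *: col 1 (g x)) i j)) => {}x.
  have [_ d1 _] := dg x.
  have := is_dmxD (dc x) (is_dmxZ (is_derive_cst (2 / a)%R x) d1).
  by move=> /(_ i j); congr is_derive; rewrite !mxE; field.
(* A reparametrization with generator [xi] moves the curve with velocity [xi e0 + (2 / a) xi' e1].
   Matching the tangential part [a k1 / 8] of the flow fixes [xi], and the [e1] part [k1' / 4] then
   agrees. *)
pose xi x := a / 8 * k1 x; pose xi' x := a / 8 * Derive k1 x.
have dxi x : is_derive xi x (xi' x).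
  apply: is_derive_eq.
    by apply: is_deriveM; [apply: is_derive_cst | apply: smooth_is_derive].
  by rewrite mul0r add0r.
have sxi' : smooth xi'.
  apply: smooth_of2; exact: smooth2M (smooth2_cst _) (smooth2_lift sk1').
(* [r] is to be the derivative of [p]. The exponential keeps it positive for every [s], whereas
   [x + s * xi x] might stop being a reparametrization. The term [s * xi 0] in [p] makes the
   [s]-derivative at 0 equal to [xi]. *)
pose r x s := exp (s * xi' x).
have sr : smooth2 r.
  apply: (smooth2_comp smooth_exp).
  exact: smooth2M smooth2_snd (smooth2_lift sxi').
have r0 x s : r x s != 0 by apply/eqP; apply: Rgt_not_eq; apply: exp_pos.
pose I x s := RInt (fun y => r y s) 0 x.
pose p x s := s * xi 0 + I x s.
have sp : smooth2 p.
  apply: smooth2D; last exact: smooth2_RInt.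
  exact: smooth2M smooth2_snd (smooth2_cst _).
have dpx x s : is_derive (fun x => p x s) x (r x s).
  apply: is_derive_eq.
    apply: is_deriveD; first exact: is_derive_cst.
    exact: smooth2_RInt_derx.
  by rewrite add0r.
have r1 x : r x 0 = 1 by rewrite -[RHS]exp_0; congr exp; exact: Rmult_0_l.
have drs x : is_derive (r x) 0 (xi' x).
  apply: is_derive_eq.
    apply: is_derive_comp1; first exact: is_derive_exp.
    by apply: is_deriveM; [apply: is_derive_idr | apply: is_derive_cst].
  by rewrite -[exp _]/(r x 0) r1 mul1r mulr0 addr0 mulr1.
have p1 x : p x 0 = x.
  rewrite /p /I (RInt_ext _ (fun=> IZR 1)); last by move=> y _; exact: r1.
  rewrite RInt_const.
  suff : Rplus (Rmult (IZR 0) (xi 0)) (Rmult (Rminus x (IZR 0)) (IZR 1)) = x by [].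
  by Lra.lra.
have dps x : is_derive (p x) 0 (xi x).
  apply: is_derive_eq.
    apply: is_deriveD; last exact: smooth2_RInt_dert.
    by apply: is_deriveM; [apply: is_derive_idr | apply: is_derive_cst].
  have -> : RInt (fun y => Dt r y 0) 0 x = xi x - xi 0.
    apply: is_RInt_unique; apply: (is_RInt_ext xi').
      by move=> y _; symmetry; exact: is_derive_unique (drs y).
    apply: (is_RInt_derive xi xi') => y _; first exact: dxi.
    by apply: ex_derive_continuous; apply: smooth_ex_derive.
  rewrite ?R0E; ring.
have sinv : smooth2 (fun x s => - (2 / a) * (r x s)^-1).
  by apply: (smooth2M (smooth2_cst _)); apply: smooth2V.
exists (fun x s => p0 + (- (2 / a) * (r x s)^-1) *: col 1 (g (p x s))); split.
- apply: smooth2_mxD; first exact: smooth2_mx_cst.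
  apply: smooth2_mxZ => //.
  apply: (@smooth2_mx_comp _ _ (fun x => col 1 (g x)) p) => //; exact: smooth_mx_col.
- move=> s; have srs := smooth2_slice s sr.
  have drx x := smooth_is_derive x srs.
  (* The third function is [m] solved from [2 r' = a m r ^ 2]; it is also the [e1] component created
     by differentiating the factor [1 / r]. *)
  apply: (@conformal_frame c g k1 a (fun x => p x s) (fun x => r x s)
    (fun x => 2 / a * Derive (fun x => r x s) x * (r x s)^-1 * (r x s)^-1)) => //.
  + exact: smooth2_slice.
  + apply: smooth_of2.
    have sri : smooth2 (fun x (_ : R) => (r x s)^-1).
      by apply: smooth2V => //; apply: smooth2_lift.
    apply: smooth2M => //; apply: smooth2M => //; apply: (smooth2M (smooth2_cst _)).
    exact: smooth2_lift (smooth_Derive srs).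
  + by move=> x; have := r0 x s => rx; field; rewrite a0 rx.
  + move=> x; have [_ d1 _] := dg (p x s); have rx := r0 x s; apply: is_dmx_eq.
      apply: is_dmxD; first exact: is_dmx_cst.
      apply: is_dmxZ; last exact: (is_dmx_comp (f := fun y => col 1 (g y)) (dpx x s) d1).
      by apply: is_deriveM; [apply: is_derive_cst | apply: is_deriveV].
    by apply/matrixP => i j; rewrite !mxE; field; rewrite a0 rx.
- by move=> x; rewrite r1 p1 invr1 mulr1 (p0E x) scaleNr.
- move=> x; rewrite (frame_airy_velocity fr) Derive_cst; apply: is_dmx_unique.
  have [_ d1 _] := dg x.
  apply: is_dmx_eq.
    apply: is_dmxD; first exact: is_dmx_cst.
    apply: is_dmxZ; last first.
      by apply: (is_dmx_comp (f := fun y => col 1 (g y)) (dps x)); rewrite p1; exact: d1.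
    apply: is_deriveM; first exact: is_derive_cst.
    by apply: is_deriveV => //; apply: drs.
  cbv beta; rewrite p1 r1 /xi /xi' ?R0E; apply/matrixP => i j; rewrite !mxE; by field.
Qed.

Lemma airy_tangent c (a : R) : smooth_mx c -> has_constant_curvature c a ->
  exists Gam : R -> R -> 'cV[R]_3, [/\ smooth2_mx Gam,
    forall s, [/\ smooth_mx (fun x => Gam x s), unit_speed (fun x => Gam x s) &
      has_constant_curvature (fun x => Gam x s) a],
    forall x, Gam x 0 = c x & forall x, Dmx (Gam x) 0 = airy_velocity c x].
Proof.
move=> sc /has_constant_curvatureP[g [k1 fr]].
have [Gam [sG frG G0 dG]] : exists Gam : R -> R -> 'cV[R]_3, [/\ smooth2_mx Gam,
    forall s, exists g' k1', null_p_frame (fun x => Gam x s) g' k1' (fun=> a),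
    forall x, Gam x 0 = c x & forall x, Dmx (Gam x) 0 = airy_velocity c x].
  have [a0|a0] := eqVneq a 0; last exact: airy_tangent_cone a0 sc fr.
  by rewrite a0 in fr *; apply: airy_tangent_null sc fr.
exists Gam; split=> // s; have [g' [k1' frs]] := frG s; split.
- exact: smooth2_mx_slice.
- exact: frame_unit_speed frs.
- by apply/has_constant_curvatureP; exists g', k1'.
Qed.

(* [delta_mx i j] has 0-based indices: [e_21 = delta_mx 1 0], etc. *)
Theorem theorem9p7 :
  (airy_invariant M0 /\ airy_invariant M0_nonzero) /\
  (forall gam : R -> R -> 'cV[R]_3,
     airy_solution gam ->
     (forall t, M0_nonzero (fun x => gam x t)) ->
     exists (g : R -> R -> 'M[R]_3) (k1 : R -> R -> R),
       [/\ forall t, null_p_frame (fun x => gam x t) (fun x => g x t)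
                       (fun x => k1 x t) (fun=> 2),
           forall x t,
             invmx (g x t) *m Dmx (fun y => g y t) x =
               k1 x t *: (delta_mx 1 0 - 2^-1 *: delta_mx 0 2)
               + 2 *: (delta_mx 2 0 - 2^-1 *: delta_mx 0 1),
           KdV (fun x t => - 2^-1 * k1 x t)
         & locally_bounded_curvature gam -> smooth2_mx g]).
Proof.
split; [split; split|].
- move=> c [sc _ [a ka]]; have [Gam [sG MG G0 dG]] := airy_tangent sc ka.
  by exists Gam; split=> // s; have [? ? ?] := MG s; split=> //; exists a.
- move=> gam sol lb t0 [_ _ [a ka]] t.
  have [r [_ kt]] := airy_invariant_M0_flow sol lb ka t; have [sgam us _] := sol.
  by split; [exact: smooth2_mx_slice | exact: us | exists (a * r)].
- move=> c [sc _ [a [a0 ka]]]; have [Gam [sG MG G0 dG]] := airy_tangent sc ka.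
  by exists Gam; split=> // s; have [? ? ?] := MG s; split=> //; exists a.
- move=> gam sol lb t0 [_ _ [a [/eqP a0 ka]]] t.
  have [r [r0 kt]] := airy_invariant_M0_flow sol lb ka t; have [sgam us _] := sol.
  split; [exact: smooth2_mx_slice | exact: us | exists (a * r); split=> //].
  by apply/eqP; rewrite mulf_neq0.
- move=> gam sol M; have [g [k1 [fr sg]]] := airy_normalized_frames sol M.
  exists g, k1; split=> // [x t|]; last exact: airy_curvature_kdv sol fr.
  by rewrite (frame_eq (fr t)) frame_mx_2.
Qed.
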